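(* Let $x_1,\dots,x_n$, $a_1,\dots,a_n$, and $c_1,\dots,c_{n}$ be indeterminates. For each $j=1,\dots,n$, let $P_j$ be an $A_{j-1}$ theta function of norm $(p^{1/2}c_1\cdots c_{n}a_{j+1}\cdots a_n)^{-1}$. Then $$\det_{1\leq i,j\leq n}\left(x_i^{-n}\prod_{k=1}^{n}\theta(c_kx_i)\,P_j(x_i)\prod_{k=j+1}^n\theta(a_kx_i)-x_i^{n+1}\prod_{k=1}^{n}\theta(c_kx_i^{-1})\,P_j(x_i^{-1})\prod_{k=j+1}^n\theta(a_kx_i^{-1})\right)$$ $$=\frac{a_1\cdots a_n\,\theta(p^{1/2})}{\theta(p^{1/2}c_1\cdots c_{n}a_1\cdots a_n)}\prod_{i=1}^nP_i(1/a_i)\prod_{i=1}^n\theta(-c_i;p^{1/2})\prod_{1\leq i<j\leq n}\theta(c_ic_j)\prod_{i=1}^n\theta(x_i;p^{1/2})\prod_{1\le i<j\le n}a_jx_i^{-1}\,\theta(x_ix_j^{\pm}).$$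
   Context: Fix $p\in\mathbb C$ with $0<|p|<1$ and a choice of square root $p^{1/2}$. Put $(a;q)_\infty=\prod_{j\ge0}(1-aq^j)$, $\theta(x;q)=(x;q)_\infty(q/x;q)_\infty$ for $x\ne0$, $\theta(x)=\theta(x;p)$, and $\theta(xy^{\pm})=\theta(xy)\theta(x/y)$. A function $f$ holomorphic on $\mathbb C\setminus\{0\}$ is called an $A_{m-1}$ theta function of norm $s$ (with $m\ge1$ and $s\in\mathbb C\setminus\{0\}$) if $f(px)=\frac{(-1)^m}{s x^m}f(x)$ for all $x\neq0$. ''Indeterminates'' are understood as nonzero complex numbers, assumed generic so that no denominators vanish. *)

(* Defs.v *)
From mathcomp Require Export all_boot all_order all_algebra.
From mathcomp Require Export complex.
From mathcomp Require Export all_classical all_reals all_analysis.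
Export Order.TTheory GRing.Theory Num.Theory.
Export numFieldNormedType.Exports.
Set Implicit Arguments.
Unset Strict Implicit.
Unset Printing Implicit Defensive.

Local Open Scope ring_scope.

(* The complex numbers are R[i] for R : realType.  The regular module R[i]^o
   carries the topology of the complex modulus, so limits and derivatives in
   it are complex ones. *)

(* (a; q)_oo.  As [lim] is total, this is meaningful only where the product
   converges, in particular for |q| < 1. *)
Definition qpoch (R : realType) (a q : R[i]) : R[i] :=
  limn (fun N : nat => (\prod_(0 <= j < N) (1 - a * q ^+ j) : R[i]^o)).

Definition theta (R : realType) (x q : R[i]) : R[i] :=
  qpoch x q * qpoch (q / x) q.

Definition holomorphic_on_Cstar (R : realType) (f : R[i] -> R[i]) : Prop :=
  forall z : R[i], z != 0 ->
    derivable (f : R[i]^o -> R[i]^o) (z : R[i]^o) (1 : R[i]^o).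

(* An A_r theta function of norm s (r = m - 1, so that m = r.+1 >= 1), with
   respect to the nome p.  The value of f at 0 plays no role. *)
Definition A_theta (R : realType) (p : R[i]) (r : nat) (s : R[i])
    (f : R[i] -> R[i]) : Prop :=
  [/\ s != 0,
      holomorphic_on_Cstar f &
      forall x : R[i], x != 0 ->
        f (p * x) = (-1) ^+ r.+1 / (s * x ^+ r.+1) * f x].

(* Main.v *)
Require Import Defs.
From mathcomp Require Import ring lra zify fingroup perm.
Set Implicit Arguments.
Unset Strict Implicit.
Unset Printing Implicit Defensive.
Local Open Scope ring_scope.

(** The entry (i, j) of the determinant is T g_j (x_i), where
      g_j (x) = P_j (x) prod_(k > j) theta (a_k x),
      T g (x) = x^-n h (x) g (x) - x^(n+1) h (1/x) g (1/x),
      h (x) = prod_k theta (c_k x).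
    All the g_j lie in one space V, that of the holomorphic f on C^* with
    f (p x) = (-1)^n sp c_1...c_n x^-n f (x), and T maps V to the space W of
    the holomorphic G with G (p x) = sp p^-n x^(-2n) G (x) and
    G (1/x) = - G (x) / x.

    Both spaces have dimension at most n.  Indeed f (p x) = c x^-m f (x) ties
    the k-th Laurent coefficient of f to the (k+m)-th one, and a holomorphic
    function on C^* whose Laurent coefficients all vanish is zero
    ([ell_unique]).  The coefficients are means over the unit circle, and
    replacing f by f (w x) only multiplies them by a power of w, by Cauchy's
    theorem ([goursat], [circ_scale]).

    In a space of dimension n, two alternating functions of n variables that
    belong to the space in each variable are proportional
    ([multi_proportional]): n-th exterior powers of n-dimensional spaces are
    lines.  The theta products [deltaA], for V, and [deltaC], for W, are such
    functions.  This gives det (g_j (x_i)) and det (T g_j (x_i)) as functions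
    of x, up to constants.

    The constant of det (g_j (x_i)) comes from putting x_n = 1/a_n, where the
    last row vanishes outside the last column, and induction on n ([typeA_eval]).  For
    det (T g_j (x_i)), one puts x = c: there the second term of T g vanishes,
    because h (1/c_i) = 0, and what is left is det (g_j (c_i))
    ([det_antisym_generic]).  That works only if [deltaC] does not vanish at c.
    The general case follows by continuity in c for the Lagrange functions of
    V, which depend on c through their multiplier only
    ([det_antisym_lagrange]), and these suffice because the g_j are linear
    combinations of them ([det_antisym_transfer]). *)

(** * Integrals of continuous functions, through primitives *)

Section Prim.
Local Open Scope classical_set_scope.
Local Open Scope complex_scope.
Import ComplexField.Normc.
Variable R : realType.
Notation mu := (@lebesgue_measure R).

(** Integrating from a fixed point serves only to the right of it; the integrals
    from -k, corrected to vanish at 0, agree with each other where they overlap. *)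
Lemma exists_primitive (f : R -> R) : continuous f ->
  exists F : R -> R, forall x : R, is_derive x 1 F (f x).
Proof.
move=> cf.
have intf u v : mu.-integrable `[u, v] (EFin \o f).
  apply: continuous_compact_integrable; first exact: segment_compact.
  exact: continuous_subspaceT.
pose G k x := (\int[mu]_(t in `[- k, x]) f t)%R.
have Gd k (x : R) : - k < x -> is_derive x 1 (G k) (f x).
  move=> kx.
  have [|dG eG] := @continuous_FTC1_closed R f (- k) x (x + 1) _ (intf _ _) kx (cf x).
    by rewrite ltrDl.
  by apply: DeriveDef; [exact: dG|rewrite -eG derive1E].
have GB k l x : k <= l -> - k <= x -> G l x = G l (- k) + G k x.
  move=> kl kx; apply/eqP; rewrite addrC -subr_eq; apply/eqP.
  rewrite /G (@Rintegral_itvB R f (BLeft (- l)) (BRight x) (- k) (intf _ _)).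
  - by rewrite Rintegral_itv_obnd_cbnd //; apply: integrableS (intf (- k) x) => //;
      apply: subset_itvr; rewrite bnd_simp.
  - by rewrite bnd_simp lerN2.
  - by rewrite bnd_simp.
pose H k x := G k x - G k 0.
have HE k l x : 0 <= k -> k <= l -> - k <= x -> H l x = H k x.
  move=> k0 kl kx; rewrite /H (GB k l x) // (GB k l 0) ?oppr_le0 //; ring.
exists (fun x => H (`|x| + 1) x) => x.
apply: (@near_eq_is_derive R R R (H (`|x| + 2))).
- near=> y.
  have xy : `|x - y| < 1 by near: y; apply: cvgr_dist_lt => //; exact: cvg_id.
  have yx : `|y| <= `|x| + 1.
    rewrite -[y](subKr x) (le_trans (ler_normB _ _)) // lerD2l; exact: ltW.
  apply: HE; first by rewrite addr_ge0.
    have := yx; lra.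
  by rewrite lerNl (le_trans (ler_norm _)) // normrN lerDl.
- rewrite /H; have -> : (fun x0 => G (`|x| + 2) x0 - G (`|x| + 2) 0) = G (`|x| + 2) - cst (G (`|x| + 2) 0) by [].
  apply: is_derive_eq; first apply: is_deriveB.
    apply: Gd; rewrite ltrNl (le_lt_trans (ler_norm _)) // normrN; lra.
  by rewrite subr0.
Unshelve. all: by end_near. Qed.

(** Integrating through a primitive makes additivity, translation and reflection
    into identities between increments, with no orientation convention. *)
Definition rint (f : R -> R) (u v : R) : R :=
  let F := xget (fun=> 0) [set F : R -> R | forall x : R, is_derive x 1 F (f x)] in
  F v - F u.

Lemma der_cont (F f : R -> R) : (forall x : R, is_derive x 1 F (f x)) -> continuous F.
Proof.
move=> dF x; apply: differentiable_continuous; apply/derivable1_diffP.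
by have [] := dF x.
Qed.

Lemma primitive_le (F f : R -> R) (u v : R) : (forall x : R, is_derive x 1 F (f x)) ->
  u <= v -> (forall x, u <= x <= v -> 0 <= f x) -> F u <= F v.
Proof.
move=> dF uv f0.
have [c cuv e] := @MVT_segment R F f u v uv (fun x _ => dF x)
  (continuous_subspaceT (der_cont dF)).
by rewrite -subr_ge0 e mulr_ge0 ?subr_ge0 // f0 // (itvP cuv).
Qed.

Lemma rintE (F f : R -> R) (u v : R) :
  (forall x : R, is_derive x 1 F (f x)) -> rint f u v = F v - F u.
Proof.
move=> dF; rewrite /rint; case: xgetP => [G _ dG|/(_ F)]; last by case.
have d0 (x : R) : is_derive x 1 (G - F) 0.
  by have := is_deriveB (dG x) (dF x); rewrite subrr.
have : forall x y, (G - F) x = (G - F) y by move=> x y; exact: (is_derive_0_is_cst x y d0).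
move=> /(_ v u); rewrite !fctE => e.
by apply/eqP; rewrite -subr_eq0; apply/eqP; move: e; lra.
Qed.

End Prim.

Section CInt.
Local Open Scope classical_set_scope.
Local Open Scope complex_scope.
Import ComplexField.Normc.
Variable R : realType.
Notation C := R[i].
Notation Re := (@complex.Re R).
Notation Im := (@complex.Im R).

Lemma normE (z : C) : `|z| = (normc z)%:C.
Proof. by []. Qed.

Lemma normc_ge0 (z : C) : 0 <= normc z.
Proof. by rewrite -ler0c -normE normr_ge0. Qed.

Lemma normc_eq0 (z : C) : (normc z == 0) = (z == 0).
Proof. by rewrite -(normr_eq0 z) normE eq_complex /= eqxx andbT. Qed.

Lemma normc_gt0 (z : C) : (0 < normc z) = (z != 0).
Proof. by rewrite lt_def normc_ge0 andbT normc_eq0. Qed.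

Lemma normcR (x : R) : normc x%:C = `|x|.
Proof. by rewrite /= expr0n addr0 sqrtr_sqr. Qed.

Lemma normcB (z w : C) : normc (z - w) <= normc z + normc w.
Proof. by rewrite (le_trans (le_normcD _ _)) // normcN. Qed.

Lemma normcC (z w : C) : normc (z - w) = normc (w - z).
Proof. by rewrite -opprB normcN. Qed.

Lemma normcX (z : C) n : normc (z ^+ n) = normc z ^+ n.
Proof. by elim: n => [|n IH]; rewrite ?expr0 ?normc1 // !exprS normcM IH. Qed.

Lemma Re_le (z : C) : `|Re z| <= normc z.
Proof. by rewrite -lecR normc_ge_Re. Qed.

Lemma Im_le (z : C) : `|Im z| <= normc z.
Proof.
case: z => a b /=; rewrite -sqrtr_sqr ler_wsqrtr // lerDr sqr_ge0 //.
Qed.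

Lemma normc_le (z : C) : normc z <= `|Re z| + `|Im z|.
Proof.
case: z => a b; have -> : a +i* b = a%:C + b%:C * 'i by simpc.
rewrite (le_trans (le_normcD _ _)) // normcM !normcR /= expr0n expr1n add0r sqrtr1 mulr1.
by rewrite !mulr0 !mul0r !mulr1 subr0 !addr0 add0r.
Qed.

(** The norm on R[i] takes its values in R[i]; all estimates below are made with
    the modulus [normc], which is real. *)
Lemma contCP (T : topologicalType) (f : T -> C) (x : T) :
  {for x, continuous (f : T -> C^o)} <->
  (forall e : R, 0 < e -> \forall y \near x, normc (f y - f x) < e).
Proof.
split=> [cf e e0|cf].
  move/(@cvgrPdist_lt _ C^o) : cf => /(_ e%:C); rewrite ltcR => /(_ e0).
  by apply: filterS => y; rewrite normE ltcR normcC.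
apply/(@cvgrPdist_lt _ C^o) => e e0.
have [k ek] : exists k, e = k%:C.
  exists (Re e); case: e e0 => a b; rewrite ltcE /= => /andP[/eqP-> _].
  by [].

move: e0; rewrite ek ltcR => /cf; apply: filterS => y.
by rewrite normE ltcR normcC.
Qed.

Lemma nbhsCP (z : C) (P : C -> Prop) :
  (\forall w \near (z : C^o), P w) <->
  (exists2 d : R, 0 < d & forall w, normc (w - z) < d -> P w).
Proof.
split=> [|[d d0 h]].
  move=> /nbhs_ballP[e /= e0 h]; move: e0; rewrite ltcE => /andP[/eqP ie re].
  exists (Re e) => // w wz; apply: h; rewrite -ball_normE /= normE normcC.
  by rewrite ltcE /= ie eqxx.
apply/nbhs_ballP; exists d%:C; first by rewrite /= ltcR.
by move=> w; rewrite -ball_normE /= normE ltcR normcC => /h.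
Qed.

Definition ccont (f : R -> C) := continuous (f : R -> C^o).

Lemma ccont_Re f : ccont f -> continuous (fun t => Re (f t)).
Proof.
move=> cf t; apply/cvgrPdist_lt => e e0; have /contCP/(_ e e0) := cf t.
by apply: filterS => y h; rewrite distrC -raddfB (le_lt_trans (Re_le _)).
Qed.

Lemma ccont_Im f : ccont f -> continuous (fun t => Im (f t)).
Proof.
move=> cf t; apply/cvgrPdist_lt => e e0; have /contCP/(_ e e0) := cf t.
by apply: filterS => y h; rewrite distrC -raddfB (le_lt_trans (Im_le _)).
Qed.

Lemma ccontP f : continuous (fun t => Re (f t)) -> continuous (fun t => Im (f t)) ->
  ccont f.
Proof.
move=> cr ci t; apply/contCP => e e0.
have e2 : 0 < e / 2 by rewrite divr_gt0.
near=> y; rewrite (le_lt_trans (normc_le _)) // [e]splitr !raddfB ltrD //= distrC; near: y.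
  by move/cvgrPdist_lt: (cr t); apply.
by move/cvgrPdist_lt: (ci t); apply.
Unshelve. all: by end_near. Qed.

(** Taken on real and imaginary parts: the variable is real, while R[i] is normed
    over itself. *)
Definition cder (F f : R -> C) := forall x : R,
  is_derive x 1 (fun t => Re (F t)) (Re (f x)) /\
  is_derive x 1 (fun t => Im (F t)) (Im (f x)).

Definition cint (f : R -> C) (u v : R) : C :=
  rint (fun t => Re (f t)) u v +i* rint (fun t => Im (f t)) u v.

Lemma cintE F f u v : cder F f -> cint f u v = F v - F u.
Proof.
move=> dF; rewrite /cint (@rintE _ _ _ u v (fun x => (dF x).1)).
rewrite (@rintE _ _ _ u v (fun x => (dF x).2)).
by case: (F u) (F v) => a b [c d].
Qed.

Lemma ccont_primitive f : ccont f -> exists F, cder F f.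
Proof.
move=> cf; have [F dF] := exists_primitive (ccont_Re cf).
have [G dG] := exists_primitive (ccont_Im cf); exists (fun t => F t +i* G t).
move=> x; split; [exact: dF|exact: dG].
Qed.

Lemma cderD F f G g : cder F f -> cder G g -> cder (fun t => F t + G t) (fun t => f t + g t).
Proof.
move=> dF dG x; have [a b] := dF x; have [c d] := dG x; split.
  have := is_deriveD a c; rewrite -raddfD; congr (is_derive _ _ _ _).
  by apply/funext => t; rewrite raddfD.
have := is_deriveD b d; rewrite -raddfD; congr (is_derive _ _ _ _).
by apply/funext => t; rewrite raddfD.
Qed.

Lemma ReM (z w : C) : Re (z * w) = Re z * Re w - Im z * Im w.
Proof. by case: z w => a b [c d]. Qed.

Lemma ImM (z w : C) : Im (z * w) = Re z * Im w + Im z * Re w.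
Proof. by case: z w => a b [c d]. Qed.

Lemma cderZ c F f : cder F f -> cder (fun t => c * F t) (fun t => c * f t).
Proof.
move=> dF x; have [a b] := dF x; split.
  have := is_deriveB (is_deriveZ (Re c) a) (is_deriveZ (Im c) b).
  rewrite -ReM; congr (is_derive _ _ _ _).
  by apply/funext => t; rewrite ReM.
have := is_deriveD (is_deriveZ (Re c) b) (is_deriveZ (Im c) a).
rewrite -ImM; congr (is_derive _ _ _ _).
by apply/funext => t; rewrite ImM.
Qed.

Lemma cder_aff (k d : R) F f : cder F f ->
  cder (fun t => F (k * t + d)) (fun t => k%:C * f (k * t + d)).
Proof.
move=> dF x; have [a b] := dF (k * x + d).
have dl : is_derive x 1 (fun t => k * t + d) k.
  have := is_deriveD (is_deriveZ k (is_derive_id x 1)) (is_derive_cst d x 1).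
  by rewrite addr0 /GRing.scale /= mulr1.
rewrite ReM ImM /= !mul0r addr0 subr0.
have a' := @is_derive1_comp _ _ _ x _ _ a dl.
have b' := @is_derive1_comp _ _ _ x _ _ b dl.
by split; rewrite mulrC.
Qed.

Lemma cint_ge0 f u v : ccont f -> u <= v -> (forall x, u <= x <= v -> 0 <= Re (f x)) ->
  0 <= Re (cint f u v).
Proof.
move=> cf uv f0; have [F dF] := ccont_primitive cf.
rewrite (cintE _ _ dF) raddfB subr_ge0.
exact: (primitive_le (fun x => (dF x).1)).
Qed.

Lemma cintD f g u v : ccont f -> ccont g ->
  cint (fun t => f t + g t) u v = cint f u v + cint g u v.
Proof.
move=> /ccont_primitive[F dF] /ccont_primitive[G dG].
rewrite (cintE _ _ dF) (cintE _ _ dG) (cintE _ _ (cderD dF dG)); ring.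
Qed.

Lemma cintZ c f u v : ccont f -> cint (fun t => c * f t) u v = c * cint f u v.
Proof.
move=> /ccont_primitive[F dF].
rewrite (cintE _ _ dF) (cintE _ _ (cderZ c dF)); ring.
Qed.

Lemma cint_chasles f u v w : ccont f -> cint f u v + cint f v w = cint f u w.
Proof. move=> /ccont_primitive[F dF]; rewrite !(cintE _ _ dF); ring. Qed.

Lemma cint_aff (k d : R) f u v : ccont f ->
  cint (fun t => k%:C * f (k * t + d)) u v = cint f (k * u + d) (k * v + d).
Proof. by move=> /ccont_primitive[F dF]; rewrite (cintE _ _ dF) (cintE _ _ (cder_aff k d dF)). Qed.

Lemma ccontZ c f : ccont f -> ccont (fun t => c * f t).
Proof. by move=> cf t; apply: cvgM; [exact: cvg_cst|exact: cf]. Qed.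

Lemma ccontD f g : ccont f -> ccont g -> ccont (fun t => f t + g t).
Proof. by move=> cf cg t; apply: (@cvgD _ C^o); [exact: cf|exact: cg]. Qed.

Lemma cst_ccont c : ccont (fun=> c).
Proof. by move=> t; exact: cvg_cst. Qed.

(** Rotate the integral onto the negative real axis and compare real parts: this
    gives the bound with constant 1. *)
Lemma cint_bound f u v M : ccont f -> u <= v ->
  (forall x, u <= x <= v -> normc (f x) <= M) ->
  normc (cint f u v) <= M * (v - u).
Proof.
move=> cf uv fM; set I := cint f u v.
have [->|I0] := eqVneq I 0; first by rewrite normc0 mulr_ge0 ?subr_ge0 // (le_trans (normc_ge0 (f u))) // fM // lexx.
set r := normc I; have r0 : 0 < r by rewrite normc_gt0.
pose c := - (r%:C / I).
have nc : normc c = 1.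
  by rewrite normcN normcM normcV normcR gtr0_norm // divff // gt_eqF.
have := @cint_ge0 (fun t => M%:C + c * f t) u v _ uv _.
rewrite cintD; [|exact: cst_ccont|exact: ccontZ].
rewrite cintZ // -/I /c mulNr divfK //.
have -> : cint (fun=> M%:C) u v = (M * (v - u))%:C.
  have dM : cder (fun t => (M * t)%:C) (fun=> M%:C).
    move=> x /=; split; last exact: is_derive_cst.
    by have := is_deriveZ M (is_derive_id x 1); rewrite /GRing.scale /= mulr1.
  by rewrite (cintE _ _ dM) -rmorphB -mulrBr.
rewrite -rmorphB => h; rewrite -subr_ge0; apply: h.
  by apply: ccontD; [exact: cst_ccont|exact: ccontZ].
move=> x xuv; have e : normc (c * f x) <= M by rewrite normcM nc mul1r fM.
have := le_trans (Re_le (c * f x)) e.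
by rewrite raddfD ler_norml => /andP[h _]; rewrite -lerBlDl sub0r.
Qed.

End CInt.

(** * Cauchy's theorem for rectangles *)

Section Goursat.
Local Open Scope classical_set_scope.
Local Open Scope complex_scope.
Import ComplexField.Normc.
Variable R : realType.
Notation C := R[i].
Notation Re := (@complex.Re R).
Notation Im := (@complex.Im R).

Lemma cont_cst (c z : C) : {for z, continuous (fun _ : C^o => c : C^o)}.
Proof. exact: (@cst_continuous C^o C^o). Qed.
Lemma cont_id (z : C) : {for z, continuous (fun w : C^o => w : C^o)}.
Proof. exact: (@cvg_id C^o). Qed.
Lemma contD (f g : C -> C) (z : C) : {for z, continuous (f : C^o -> C^o)} ->
  {for z, continuous (g : C^o -> C^o)} -> {for z, continuous (fun w : C^o => f w + g w : C^o)}.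
Proof. exact: (@continuousD _ C^o C^o). Qed.
Lemma contM (f g : C -> C) (z : C) : {for z, continuous (f : C^o -> C^o)} ->
  {for z, continuous (g : C^o -> C^o)} -> {for z, continuous (fun w : C^o => f w * g w : C^o)}.
Proof. exact: (@continuousM _ C^o). Qed.

(** Caratheodory's form of complex differentiability, under which products and
    compositions are algebra. *)
Definition cdiff (f : C -> C) (z : C) :=
  exists2 phi : C -> C, {for z, continuous (phi : C^o -> C^o)} &
    forall w, f w = f z + phi w * (w - z).

Lemma cdiff_cont f z : cdiff f z -> {for z, continuous (f : C^o -> C^o)}.
Proof.
move=> [phi cphi fE].
have -> : f = (fun w => f z + phi w * (w + - z)) by apply/funext => w; exact: fE.
have ci := @contD id (fun=> - z) z (@cont_id z) (@cont_cst (- z) z).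
exact: (@contD (fun=> f z) (fun w => phi w * (w + - z)) z (@cont_cst (f z) z)
  (@contM phi (fun w => w + - z) z cphi ci)).
Qed.

Lemma cdiff_local f z : cdiff f z -> exists d, forall e : R, 0 < e ->
  exists2 k : R, 0 < k & forall w, normc (w - z) < k ->
    normc (f w - (f z + d * (w - z))) <= e * normc (w - z).
Proof.
move=> [phi /contCP cphi fE]; exists (phi z) => e /cphi/nbhsCP[k k0 h].
exists k => // w /h lt; rewrite fE.
have -> : f z + phi w * (w - z) - (f z + phi z * (w - z)) = (phi w - phi z) * (w - z) by ring.
by rewrite normcM ler_wpM2r ?normc_ge0 // ltW.
Qed.

Lemma path_ccont (F : C -> C) (g : R -> C) : (forall z, cdiff F z) -> ccont g ->
  ccont (fun t => F (g t)).
Proof.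
move=> dF cg t; apply: (@continuous_comp _ _ _ (g : R -> C^o) (F : C^o -> C^o)); first exact: cg.
exact: cdiff_cont.
Qed.

Lemma horiz_ccont b : ccont (fun t : R => t +i* b).
Proof. by apply: ccontP => t /=; [exact: cvg_id|exact: cvg_cst]. Qed.

Lemma vert_ccont a : ccont (fun t : R => a +i* t).
Proof. by apply: ccontP => t /=; [exact: cvg_cst|exact: cvg_id]. Qed.

(** The sides are oriented counterclockwise; the 'i on the vertical ones is du
    for u = a +i* y. *)
Definition rectint (F : C -> C) (a a' b b' : R) : C :=
  cint (fun x => F (x +i* b)) a a' + 'i * cint (fun y => F (a' +i* y)) b b'
  - cint (fun x => F (x +i* b')) a a' - 'i * cint (fun y => F (a +i* y)) b b'.

Definition path_cont (F : C -> C) :=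
  (forall b, ccont (fun x => F (x +i* b))) /\ (forall a, ccont (fun y => F (a +i* y))).

Lemma rectint_split F a m a' b n b' : path_cont F ->
  rectint F a a' b b' = rectint F a m b n + rectint F m a' b n
    + (rectint F a m n b' + rectint F m a' n b').
Proof.
move=> [ch cv]; rewrite /rectint.
rewrite -(@cint_chasles _ _ a m a' (ch b)) -(@cint_chasles _ _ a m a' (ch b')).
rewrite -(@cint_chasles _ _ b n b' (cv a)) -(@cint_chasles _ _ b n b' (cv a')).
ring.
Qed.

(** Affine functions have a primitive; the argument is run on each side with the
    explicit one, c u + d u^2 / 2. *)
Lemma rectint_affine (c d : C) a a' b b' : rectint (fun u => c + d * u) a a' b b' = 0.
Proof.
have dh (q : C) (p : C) (k : R) : p = 1 \/ p = 'i ->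
   cder (fun t => c * (p * t%:C) + d * (q * (p * t%:C) + p * p * (t ^+ 2 / 2)%:C))
     (fun t => p * (c + d * (q + p * t%:C))).
  move=> pE.
  have d1 : cder (fun t => t%:C : C) (fun=> 1).
    by move=> x; split; [exact: is_derive_id|exact: is_derive_cst].
  have d2 : cder (fun t => (t ^+ 2 / 2)%:C : C) (fun t => t%:C).
    move=> x; split; last exact: is_derive_cst.
    rewrite (_ : (fun t => _) = 2^-1 \*: (id ^+ 2 : R -> R)); last first.
      by apply/funext => t /=; rewrite mulrC.
    apply: (is_derive_eq (is_deriveZ 2^-1 (is_deriveX 2 (is_derive_id x (1 : R))))).
    by rewrite /GRing.scale /= expr1; field.
  have h := cderD (cderZ (c * p) d1) (cderD (cderZ (d * q * p) d1) (cderZ (d * p * p) d2)).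
  move: h; congr cder; apply/funext => t; ring.
pose PH (y : R) t : C := c * t%:C + d * (('i * y%:C) * t%:C + (t ^+ 2 / 2)%:C).
pose PV (x : R) t : C := c * ('i * t%:C) + d * (x%:C * ('i * t%:C) + 'i * 'i * (t ^+ 2 / 2)%:C).
have hE y : cint (fun x => c + d * (x +i* y)) a a' =
   PH y a' - PH y a.
  apply: (@cintE _ (PH y)); have := dh ('i * y%:C) 1 0 (or_introl erefl).
  congr cder; apply/funext => t; rewrite !mul1r //; congr (c + d * _).
  by simpc.
have vE x : 'i * cint (fun y => c + d * (x +i* y)) b b' =
   PV x b' - PV x b.
  rewrite -cintZ; last first.
    by apply: ccontD; [exact: cst_ccont|apply: ccontZ; exact: vert_ccont].
  apply: (@cintE _ (PV x)); have := dh x%:C 'i 0 (or_intror erefl).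
  congr cder; apply/funext => t; congr ('i * (c + d * _)).
  by simpc.
rewrite /rectint !hE !vE /PH /PV; ring.
Qed.

Lemma rectint_bound F a a' b b' e : path_cont F -> a <= a' -> b <= b' ->
  (forall x y, a <= x <= a' -> b <= y <= b' -> normc (F (x +i* y)) <= e) ->
  normc (rectint F a a' b b') <= 2 * e * ((a' - a) + (b' - b)).
Proof.
move=> [ch cv] aa bb Fe; rewrite /rectint.
have ni : normc ('i : C) = 1 by rewrite /= expr0n expr1n add0r sqrtr1.
have h1 := @cint_bound _ _ a a' e (ch b) aa (fun x h => Fe x b h (introT andP (conj (lexx b) bb))).
have h2 := @cint_bound _ _ a a' e (ch b') aa (fun x h => Fe x b' h (introT andP (conj bb (lexx b')))).
have h3 := @cint_bound _ _ b b' e (cv a) bb (fun x h => Fe a x (introT andP (conj (lexx a) aa)) h).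
have h4 := @cint_bound _ _ b b' e (cv a') bb (fun x h => Fe a' x (introT andP (conj aa (lexx a'))) h).
apply: (le_trans (normcB _ _)); apply: (le_trans (lerD (normcB _ _) (lexx _))).
apply: (le_trans (lerD (lerD (le_normcD _ _) (lexx _)) (lexx _))).
rewrite !normcM ni !mul1r; nra.
Qed.

Lemma entire_path_cont F : (forall z, cdiff F z) -> path_cont F.
Proof. by move=> dF; split=> ?; apply: path_ccont => //; [exact: horiz_ccont|exact: vert_ccont]. Qed.

(** Near z, F is affine up to e |u - z|, and the affine part integrates to 0.
    The bound is quadratic in the size of the rectangle, which is what the
    bisection needs. *)
Lemma rectint_local F z : (forall z, cdiff F z) -> forall e : R, 0 < e ->
  exists2 k : R, 0 < k & forall a a' b b', a <= Re z <= a' -> b <= Im z <= b' ->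
    (a' - a) + (b' - b) < k ->
    normc (rectint F a a' b b') <= 2 * e * ((a' - a) + (b' - b)) ^+ 2.
Proof.
move=> dF e e0; have [d /(_ e e0)[k k0 hk]] := cdiff_local (dF z).
exists k => // a a' b b' za zb sk.
have [ch cv] := entire_path_cont dF.
pose G u := (F z - d * z) + d * u; pose H u := F u - G u.
have cg (g : R -> C) : ccont g -> ccont (fun t => G (g t)).
  by move=> cg; apply: ccontD; [exact: cst_ccont|exact: ccontZ].
have cH : path_cont H.
  split=> x.
    have -> : (fun t => H (t +i* x)) = (fun t => F (t +i* x) + -1 * G (t +i* x)).
      by apply/funext => t; rewrite mulN1r.
    by apply: ccontD => //; apply: ccontZ; apply: cg; exact: horiz_ccont.
  have -> : (fun t => H (x +i* t)) = (fun t => F (x +i* t) + -1 * G (x +i* t)).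
    by apply/funext => t; rewrite mulN1r.
  by apply: ccontD => //; apply: ccontZ; apply: cg; exact: vert_ccont.
have -> : rectint F a a' b b' = rectint G a a' b b' + rectint H a a' b b'.
  rewrite /rectint.
  have hs y : cint (fun x => F (x +i* y)) a a' = cint (fun x => G (x +i* y)) a a' + cint (fun x => H (x +i* y)) a a'.
    rewrite -cintD; [|apply: cg; exact: horiz_ccont|exact: cH.1].
    by congr cint; apply/funext => t; rewrite /H addrC subrK.
  have vs x : cint (fun y => F (x +i* y)) b b' = cint (fun y => G (x +i* y)) b b' + cint (fun y => H (x +i* y)) b b'.
    rewrite -cintD; [|apply: cg; exact: vert_ccont|exact: cH.2].
    by congr cint; apply/funext => t; rewrite /H addrC subrK.
  rewrite !hs !vs; ring.
rewrite rectint_affine add0r expr2 (mulrA (2 * e)) -(mulrA 2).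
move/andP: za => [za za']; move/andP: zb => [zb zb'].
have le1 (x u v w : R) : u <= x <= v -> u <= w <= v -> `|x - w| <= v - u.
  by move=> /andP[? ?] /andP[? ?]; rewrite ler_norml; apply/andP; split; lra.
apply: rectint_bound => //; [lra|lra|].
move=> x y hx hy.
have sz : normc (x +i* y - z) <= (a' - a) + (b' - b).
  rewrite (le_trans (normc_le _)) // !raddfB /= lerD //; apply: le1 => //; exact/andP.
have -> : H (x +i* y) = F (x +i* y) - (F z + d * (x +i* y - z)) by rewrite /H /G; ring.
rewrite (le_trans (hk _ _)) ?(le_lt_trans sz) //.
by rewrite ler_pM2l.
Qed.

Lemma nested_point (u v : nat -> R) : (forall n, u n <= u n.+1) -> (forall n, v n.+1 <= v n) ->
  (forall n, u n <= v n) -> exists x, forall n, u n <= x <= v n.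
Proof.
move=> iu dv uv.
have nu : {homo u : m n / (m <= n)%N >-> m <= n} by apply: homo_leq => // ? ? ?; exact: le_trans.
have nv : {homo v : m n / (m <= n)%N >-> n <= m} by apply: homo_leq => // a b c h1 h2; exact: le_trans h2 h1.
have uv' m n : u m <= v n.
  by rewrite (le_trans (nu _ _ (leq_maxl m n))) // (le_trans (uv _)) // nv ?leq_maxr.
exists (sup (range u)) => n; apply/andP; split.
  apply: ub_le_sup; last by exists n.
  by exists (v 0) => _ [m _ <-].
by apply: ge_sup; [exists (u 0), 0|move=> _ [m _ <-]].
Qed.

(** Goursat's bisection: one of the four quarters carries at least a quarter of
    the integral, so the nested rectangles contradict [rectint_local] at their
    common point, unless the integral is 0. *)
Theorem goursat F : (forall z, cdiff F z) -> forall a b w h, 0 <= w -> 0 <= h ->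
  rectint F a (a + w) b (b + h) = 0.
Proof.
move=> dF a b w h w0 h0.
have cF := entire_path_cont dF.
pose W n := w / 2 ^+ n; pose H n := h / 2 ^+ n.
have WS n : W n = W n.+1 + W n.+1 by rewrite /W exprS; field; rewrite expf_neq0.
have HS n : H n = H n.+1 + H n.+1 by rewrite /H exprS; field; rewrite expf_neq0.
have W0 n : 0 <= W n by rewrite divr_ge0 // exprn_ge0.
have H0 n : 0 <= H n by rewrite divr_ge0 // exprn_ge0.
pose J n (r : R * R) := normc (rectint F r.1 (r.1 + W n) r.2 (r.2 + H n)).
have step (nr : nat * (R * R)) : exists r' : R * R,
    [/\ nr.2.1 <= r'.1 <= nr.2.1 + W nr.1.+1, nr.2.2 <= r'.2 <= nr.2.2 + H nr.1.+1 &
      J nr.1 nr.2 <= 4 * J nr.1.+1 r'].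
  case: nr => n [x y] /=; set x' := x + _; set y' := y + _.
  have xx : x <= x' by rewrite lerDl.
  have yy : y <= y' by rewrite lerDl.
  have e : rectint F x (x + W n) y (y + H n) = rectint F x x' y y' + rectint F x' (x' + W n.+1) y y'
      + (rectint F x x' y' (y' + H n.+1) + rectint F x' (x' + W n.+1) y' (y' + H n.+1)).
    by rewrite (WS n) (HS n) (addrA x) (addrA y); exact: rectint_split.
  have le4 : J n (x, y) <= J n.+1 (x, y) + J n.+1 (x', y) + (J n.+1 (x, y') + J n.+1 (x', y')).
    have -> : J n (x, y) = normc (rectint F x (x + W n) y (y + H n)) by [].
    rewrite e; apply: (le_trans (le_normcD _ _)).
    by apply: lerD; exact: le_normcD.
  have [c1|c1] := leP (J n (x, y)) (4 * J n.+1 (x, y)).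
    by exists (x, y); split; rewrite //= ?lexx ?xx ?yy.
  have [c2|c2] := leP (J n (x, y)) (4 * J n.+1 (x', y)).
    by exists (x', y); split; rewrite //= ?lexx ?xx ?yy.
  have [c3|c3] := leP (J n (x, y)) (4 * J n.+1 (x, y')).
    by exists (x, y'); split; rewrite //= ?lexx ?xx ?yy.
  by exists (x', y'); split; rewrite //= ?lexx ?xx ?yy //; move: c1 c2 c3 le4; lra.
have [g gP] := choice step.
pose r := fix r n := if n is m.+1 then g (m, r m) else (a, b).
have rS n := gP (n, r n).
have [x hx] : exists x, forall n, (r n).1 <= x <= (r n).1 + W n.
  apply: nested_point => n; last by rewrite lerDl.
    by have [/andP[]] := rS n.
  have [/andP[_ /= h1] _ _] := rS n.
  by rewrite [in leRHS]WS addrA lerD2r.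
have [y hy] : exists y, forall n, (r n).2 <= y <= (r n).2 + H n.
  apply: nested_point => n; last by rewrite lerDl.
    by have [_ /andP[]] := rS n.
  have [_ /andP[_ /= h1] _] := rS n.
  by rewrite [in leRHS]HS addrA lerD2r.
have Jn n : J 0 (a, b) <= 4 ^+ n * J n (r n).
  elim: n => [|n IH]; first by rewrite mul1r.
  have [_ _ /= h1] := rS n.
  by rewrite exprSr -mulrA (le_trans IH) // ler_pM2l // exprn_gt0.
set s := w + h; have s0 : 0 <= s by rewrite addr_ge0.
have Jle e : 0 < e -> J 0 (a, b) <= 2 * e * s ^+ 2.
  move=> e0; have [k k0 hk] := rectint_local (x +i* y) dF e0.
  have [n hn] : exists n, s / 2 ^+ n < k.
    exists (Num.bound (s / k)); rewrite ltr_pdivrMr ?exprn_gt0 // mulrC -ltr_pdivrMr //.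
    rewrite (lt_trans (archi_boundP _)) ?divr_ge0 ?(ltW k0) //.
    by rewrite -natrX ltr_nat ltn_expl.
  have := hk _ _ _ _ (hx n) (hy n).
  have sE : (r n).1 + W n - (r n).1 + ((r n).2 + H n - (r n).2) = s / 2 ^+ n.
    by rewrite /W /H /s; ring.
  rewrite sE => /(_ hn) le2; rewrite (le_trans (Jn n)) //.
  have -> : 2 * e * s ^+ 2 = 4 ^+ n * (2 * e * (s / 2 ^+ n) ^+ 2).
    have -> : (4 : R) ^+ n = (2 ^+ n) ^+ 2 by rewrite -exprM mulnC exprM; congr (_ ^+ _); ring.
    by field; rewrite expf_neq0.
  by rewrite ler_pM2l // exprn_gt0.
have J0 : J 0 (a, b) = 0.
  apply/eqP; rewrite eq_le normc_ge0 andbT; apply/ler_addgt0Pl => e e0; rewrite addr0.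
  have q0 : 0 < s ^+ 2 + 1 by rewrite ltr_wpDl // sqr_ge0.
  rewrite (le_trans (Jle (e / (2 * (s ^+ 2 + 1))) _)) ?divr_gt0 // ?mulr_gt0 //.
  have -> : 2 * (e / (2 * (s ^+ 2 + 1))) * s ^+ 2 = e * (s ^+ 2 / (s ^+ 2 + 1)).
    by field; rewrite gt_eqF.
  by rewrite ler_piMr ?(ltW e0) // ler_pdivrMr // mul1r lerDl.
apply/eqP; rewrite -normc_eq0; move/eqP: J0; rewrite /J /= /W /H expr0 !divr1 //.
Qed.

End Goursat.

(** * Functions holomorphic on the punctured plane *)

Section Hol.
Local Open Scope classical_set_scope.
Local Open Scope complex_scope.
Import ComplexField.Normc.
Variable R : realType.
Notation C := R[i].
Notation Re := (@complex.Re R).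
Notation Im := (@complex.Im R).

Lemma cdiff_cst (c z : C) : cdiff (fun=> c) z.
Proof. by exists (fun=> 0); [exact: cont_cst|move=> w; rewrite mul0r addr0]. Qed.

Lemma cdiff_id (z : C) : cdiff id z.
Proof. by exists (fun=> 1); [exact: cont_cst|move=> w; rewrite mul1r addrC subrK]. Qed.

Lemma cdiffD (f g : C -> C) z : cdiff f z -> cdiff g z -> cdiff (fun w => f w + g w) z.
Proof.
move=> [p cp fE] [q cq gE]; exists (fun w => p w + q w); first exact: contD.
by move=> w; rewrite {1}fE {1}gE; ring.
Qed.

Lemma cdiffM (f g : C -> C) z : cdiff f z -> cdiff g z -> cdiff (fun w => f w * g w) z.
Proof.
move=> df dg; have cg := cdiff_cont dg; move: df dg => [p cp fE] [q cq gE].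
exists (fun w => p w * g w + f z * q w).
  apply: (@contD R (fun w => p w * g w) (fun w => f z * q w)).
    exact: (@contM R p g z cp cg).
  exact: (@contM R (fun=> f z) q z (@cont_cst R (f z) z) cq).
move=> w; have := gE w => gw; rewrite {1}fE mulrDl {1}gw; ring.
Qed.

Lemma cdiff_comp (f g : C -> C) z : cdiff g z -> cdiff f (g z) -> cdiff (fun w => f (g w)) z.
Proof.
move=> dg; have cg := cdiff_cont dg; move: dg => [q cq gE] [p cp fE].
exists (fun w => p (g w) * q w).
  exact: (@contM R (fun w => p (g w)) q z (@continuous_comp C^o C^o C^o g p z cg cp) cq).
move=> w; have e : g w - g z = q w * (w - z) by rewrite (gE w); ring.
by rewrite {1}fE e mulrA.
Qed.

Lemma near_neq0 (z : C) : z != 0 -> \forall w \near (z : C^o), w != 0.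
Proof.
move=> z0; apply/nbhsCP; exists (normc z); first by rewrite normc_gt0.
by move=> w; apply: contraTneq => ->; rewrite sub0r normcN ltxx.
Qed.

Lemma cdiffV (z : C) : z != 0 -> cdiff (fun w => w^-1) z.
Proof.
(* the value of the quotient at 0 is forced by 0^-1 = 0 *)
move=> z0; exists (fun w => if w == 0 then z^-1 ^+ 2 else - (z^-1 * w^-1)); last first.
  move=> w; case: eqVneq => [->|w0]; first by rewrite invr0; field.
  by field; rewrite w0.
have cv : {for z, continuous (fun w : C^o => - (z^-1 * w^-1) : C^o)}.
  apply: (@continuousN _ C^o C^o (fun w => z^-1 * w^-1)).
  apply: (@contM R (fun=> z^-1) (fun w => w^-1)); first exact: cont_cst.
  exact: (@inv_continuous C).
apply/contCP => e e0; move/contCP: cv => /(_ e e0); rewrite (negbTE z0).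
by apply: filterS2 (near_neq0 z0) => w w0; rewrite ifN.
Qed.

Lemma cdiffX (f : C -> C) n z : cdiff f z -> cdiff (fun w => f w ^+ n) z.
Proof.
move=> df; elim: n => [|n IH]; first exact: cdiff_cst.
rewrite (_ : (fun w => _) = (fun w => f w * f w ^+ n)); first exact: cdiffM.
by apply/funext => w; rewrite exprS.
Qed.

Lemma cdiff_prod (I : finType) (P : pred I) (F : I -> C -> C) z :
  (forall i, P i -> cdiff (F i) z) -> cdiff (fun w => \prod_(i | P i) F i w) z.
Proof.
move=> dF; rewrite (_ : (fun w => _) = \big[(fun f g w => f w * g w)/(fun=> 1)]_(i | P i) F i).
  by elim/big_ind : _ => // [|f g]; [exact: cdiff_cst|exact: cdiffM].
apply/funext => w; apply: (big_ind2 (fun x (f : C -> C) => x = f w)) => //.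
by move=> x f y g -> ->.
Qed.

Lemma cdiff_exprz (k : int) (z : C) : z != 0 -> cdiff (fun w => w ^ k) z.
Proof.
move=> z0; case: k => n; first exact: (cdiffX n (cdiff_id z)).
rewrite (_ : (fun w => _) = (fun w : C => w^-1 ^+ n.+1)); first exact: cdiffX (cdiffV z0).
by apply/funext => w; rewrite NegzE exprVn.
Qed.

Definition hol (f : C -> C) := forall z : C, z != 0 -> cdiff f z.

(** Holomorphy on C^* does not see the value at 0, but Caratheodory's quotient
    does, since it is required at all points; it can be redefined at 0. *)
Lemma eq_hol (f g : C -> C) : (forall z, z != 0 -> f z = g z) -> hol f -> hol g.
Proof.
move=> fg hf z z0; have [p cp fE] := hf z z0.
exists (fun w => if w == 0 then - (g w - g z) / z else p w); last first.
  move=> w; case: eqVneq => [->|w0]; first by field.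
  by rewrite -!fg // fE.
apply/contCP => e e0; move/contCP: cp => /(_ e e0); rewrite (negbTE z0).
by apply: filterS2 (near_neq0 z0) => w w0; rewrite ifN.
Qed.

(** The complex exponential, through which C^* is seen as a strip of the plane
    where rectangles are annuli. *)
Definition expc (u : C) : C := (expR (Re u))%:C * (cos (Im u) +i* sin (Im u)).

Lemma expcD u v : expc (u + v) = expc u * expc v.
Proof.
rewrite /expc !raddfD /= expRD rmorphM cosD sinD.
set a := cos _; set b := sin _; set c := cos _; set d := sin _.
have -> : ((a * c - b * d) +i* (b * c + a * d)) = (a +i* b) * (c +i* d).
  by simpc; congr (_ +i* _); ring.
ring.
Qed.

Lemma expc0 : expc 0 = 1.
Proof. by rewrite /expc /= expR0 cos0 sin0 mul1r. Qed.

Lemma expc_neq0 u : expc u != 0.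
Proof.
apply/negP => /eqP h; have := expcD u (- u).
by rewrite subrr expc0 h mul0r => /eqP; rewrite oner_eq0.
Qed.

Lemma expcN u : expc (- u) = (expc u)^-1.
Proof. by apply: (mulfI (expc_neq0 u)); rewrite -expcD subrr expc0 divff // expc_neq0. Qed.

Lemma is_derive_local (g : R -> R) d : is_derive (0 : R) 1 g d -> forall e : R, 0 < e ->
  exists2 k : R, 0 < k & forall a, `|a| < k -> `|g a - g 0 - d * a| <= e * `|a|.
Proof.
move=> [dg gd] e e0.
have : (fun h : R => h^-1 *: (g (h *: 1 + 0) - g 0)) @ 0^' --> d by rewrite -gd; exact: dg.
move=> /cvgrPdist_lt/(_ e e0); rewrite near_withinE => /nbhs_ballP[k /= k0 h].
exists k => // a ak; have [->|a0] := eqVneq a 0.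
  by rewrite normr0 mulr0 !mulr0 subrr subr0 normr0.
have := h a; rewrite -ball_normE /= sub0r normrN => /(_ ak a0).
rewrite /GRing.scale /= mulr1 addr0 => /ltW h1.
have -> : g a - g 0 - d * a = - (d - a^-1 * (g a - g 0)) * a by field.
by rewrite normrM normrN ler_wpM2r.
Qed.

(** The error of the linear approximation splits into the three real ones, of
    exp, cos and sin, each with a bounded factor. *)
Lemma expc_order1 (e : R) : 0 < e -> exists2 k : R, 0 < k & forall h, normc h < k ->
  normc (expc h - 1 - h) <= e * normc h.
Proof.
move=> e0; have [e' [e'0 e1 e8]] : exists e' : R, [/\ 0 < e', e' <= 1 & e' <= e / 9].
  exists (Num.min 1 (e / 9)); rewrite !ge_min !lexx orbT; split=> //.
  by rewrite lt_min ltr01 divr_gt0.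
have [k1 k10 h1] := is_derive_local (is_derive_expR (0 : R)) e'0.
have [k2 k20 h2] := is_derive_local (is_derive_cos (0 : R)) e'0.
have [k3 k30 h3] := is_derive_local (is_derive_sin (0 : R)) e'0.
exists (Num.min (Num.min k1 e') (Num.min k2 k3)); first by rewrite !lt_min k10 k20 k30 e'0.
case=> a b; set N := normc _; rewrite !lt_min => /andP[/andP[n1 n4] /andP[n2 n3]].
have aN : `|a| <= N by exact: (Re_le (a +i* b)).
have bN : `|b| <= N by exact: (Im_le (a +i* b)).
have := h1 a (le_lt_trans aN n1); have := h2 b (le_lt_trans bN n2).
have := h3 b (le_lt_trans bN n3).
rewrite !expR0 !cos0 !sin0 oppr0 !mul0r !mul1r !subr0 ?addr0.
set E := expR a; set c := cos b; set s := sin b => hs hc hE.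
have N0 : 0 <= N := normc_ge0 _.

have E3 : `|E - 1| <= 2 * N.
  have -> : E - 1 = (E - 1 - a) + a by ring.
  by rewrite (le_trans (ler_normD _ _)) //; nra.
have E4 : `|E| <= 3.
  have -> : E = (E - 1) + 1 by ring.
  by rewrite (le_trans (ler_normD _ _)) // normr1; nra.
have -> : expc (a +i* b) - 1 - (a +i* b) =
   ((E - 1 - a) + E * (c - 1)) +i* (E * (s - b) + (E - 1) * b).
  by rewrite /expc /= -/E -/c -/s; simpc; congr (_ +i* _); ring.
apply: (le_trans (normc_le _)) => /=.
apply: (le_trans (lerD (ler_normD _ _) (ler_normD _ _))); rewrite !normrM.
have eN : e' * `|b| <= e' * N by rewrite ler_pM2l.
have p1 : `|E| * `|c - 1| <= 3 * (e' * N) by apply: ler_pM => //; exact: le_trans hc eN.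
have p2 : `|E| * `|s - b| <= 3 * (e' * N) by apply: ler_pM => //; exact: le_trans hs eN.
have p3 : `|E - 1| * `|b| <= 2 * N * e'.
  by apply: ler_pM => //; rewrite (le_trans bN) // ltW.
have aN' : e' * `|a| <= e' * N by rewrite ler_pM2l.
have e9 : e' * N <= e / 9 * N by rewrite ler_wpM2r.
lra.
Qed.

Lemma cdiff_expc u : cdiff expc u.
Proof.
have d0 : cdiff expc 0.
  exists (fun h => if h == 0 then 1 else (expc h - 1) / h); last first.
    move=> h; rewrite expc0 subr0; case: eqVneq => [->|h0].
      by rewrite expc0 mulr0 addr0.
    by field.
  apply/contCP => e e0; rewrite eqxx.
  have [k k0 hk] := expc_order1 (divr_gt0 e0 (ltr0Sn R 1)).
  apply/nbhsCP; exists k => // w; rewrite subr0 => /hk.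
  case: eqVneq => [_ _|w0 h]; first by rewrite subrr normc0.
  have -> : (expc w - 1) / w - 1 = (expc w - 1 - w) / w by field.
  rewrite normcM normcV ltr_pdivrMr ?normc_gt0 // (le_lt_trans h) //.
  by rewrite ltr_pM2r ?normc_gt0 // ltr_pdivrMr // ltr_pMr // ltr1n.
have -> : expc = (fun w => expc u * expc (w + - u)).
  by apply/funext => w; rewrite -expcD addrC subrK.
apply: cdiffM; first exact: cdiff_cst.
apply: (@cdiff_comp expc (fun w => w + - u)); last by rewrite subrr.
by apply: cdiffD; [exact: cdiff_id|exact: cdiff_cst].
Qed.

Lemma expc_surj (w : C) : w != 0 -> exists u, expc u = w.
Proof.
move=> w0; have r0 : 0 < normc w by rewrite normc_gt0.
pose c := Re w / normc w; pose s := Im w / normc w.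
have cs : c ^+ 2 + s ^+ 2 = 1.
  have : normc w ^+ 2 = Re w ^+ 2 + Im w ^+ 2.
    by case: w {w0 c s r0} => a b /=; rewrite sqr_sqrtr // addr_ge0 // sqr_ge0.
  by rewrite /c /s => h; rewrite !expr_div_n -mulrDl -h divff // expf_neq0 // gt_eqF.
have c1 : -1 <= c <= 1 by apply/andP; move: (sqr_ge0 s); split; nra.
have wE : w = (normc w)%:C * (c +i* s).
  rewrite /c /s; case: w {cs c1 c s} w0 r0 => a b w0 r0; set r := normc _ in r0 *.
  move: r r0 => r r0 /=; simpc; congr (_ +i* _); rewrite mulrCA divff ?mulr1 // gt_eqF //.
have [t [tc ts]] : exists t, cos t = c /\ sin t = s.
  have sa : sin (acos c) = `|s|.
    rewrite sin_acos //; have -> : 1 - c ^+ 2 = s ^+ 2 by rewrite -cs; ring.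
    exact: sqrtr_sqr.
  have [s0|s0] := leP 0 s.
    by exists (acos c); rewrite acosK ?sa ?ger0_norm //; exact/andP.
  by exists (- acos c); rewrite cosN sinN acosK ?sa ?ltr0_norm ?opprK.
by exists (ln (normc w) +i* t); rewrite /expc /= lnK // tc ts -wE.
Qed.

End Hol.

(** * Laurent coefficients *)

Section Fourier.
Local Open Scope classical_set_scope.
Local Open Scope complex_scope.
Import ComplexField.Normc.
Variable R : realType.
Notation C := R[i].
Notation Re := (@complex.Re R).
Notation Im := (@complex.Im R).

Implicit Types f g : C -> C.

Lemma expc_period (t : R) : expc (0 +i* (t + pi *+ 2)) = expc (0 +i* t).
Proof. by rewrite /expc /= cosD2pi sinD2pi. Qed.

Definition circ (f : C -> C) : C := cint (fun t => f (expc (0 +i* t))) 0 (pi *+ 2).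

Lemma eq_circ (f g : C -> C) : (forall x, x != 0 -> f x = g x) -> circ f = circ g.
Proof.
by move=> fg; rewrite /circ; congr cint; apply/funext => t; rewrite fg // expc_neq0.
Qed.

Lemma hol_expc f : hol f -> forall u, cdiff (fun u => f (expc u)) u.
Proof.
move=> hf u; apply: (@cdiff_comp _ f (@expc R)); first exact: cdiff_expc.
exact/hf/expc_neq0.
Qed.

Lemma hol_ccont f a : hol f -> ccont (fun t => f (expc (a +i* t))).
Proof.
move=> hf; apply: (@path_ccont _ (fun u => f (expc u))); first exact: hol_expc.
exact: vert_ccont.
Qed.

Lemma circD f g : hol f -> hol g -> circ (fun x => f x + g x) = circ f + circ g.
Proof. by move=> hf hg; apply: cintD; exact: hol_ccont. Qed.

Lemma circZ c f : hol f -> circ (fun x => c * f x) = c * circ f.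
Proof. by move=> hf; apply: cintZ; exact: hol_ccont. Qed.

Lemma cint_period (f : R -> C) T b : ccont f -> (forall t, f (t + T) = f t) ->
  cint f b (b + T) = cint f 0 T.
Proof.
move=> cf fT; have := cint_aff 1 T 0 b cf.
rewrite !mul1r add0r => h.
have h' : cint f 0 b = cint f T (b + T).
  by rewrite -h; congr cint; apply/funext => t; rewrite mul1r fT mul1r.
have h1 := cint_chasles 0 b (b + T) cf; have h2 := cint_chasles 0 T (b + T) cf.
by move: h1; rewrite -h2 h' addrC => /addIr.
Qed.

(** Cauchy's theorem on an annulus.  In the coordinate log x, multiplication by w
    moves a vertical segment of length 2 pi; moving it along itself is harmless by
    periodicity, and moving it sideways is the theorem for a rectangle whose
    horizontal sides cancel, again by periodicity. *)
Lemma circ_scale f w : hol f -> w != 0 -> circ (fun x => f (w * x)) = circ f.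
Proof.
move=> hf /expc_surj[[a b] <-]; rewrite /circ.
have -> : (fun t => f (expc (a +i* b) * expc (0 +i* t))) =
    (fun t => 1%:C * f (expc (a +i* (1 * t + b)))).
  apply/funext => t; rewrite -expcD mul1r mul1r; congr (f (expc _)).
  by simpc; rewrite addrC.
rewrite (@cint_aff _ 1 b (fun t => f (expc (a +i* t)))); last exact: hol_ccont.
rewrite mulr0 add0r mul1r addrC cint_period; first last.
- by move=> t; congr f; rewrite /expc /= cosD2pi sinD2pi.
- exact: hol_ccont.
have main (x y : R) : x <= y -> cint (fun t => f (expc (x +i* t))) 0 (pi *+ 2) =
    cint (fun t => f (expc (y +i* t))) 0 (pi *+ 2).
  move=> xy; have yx0 : 0 <= y - x by rewrite subr_ge0.
  have p0 : 0 <= pi *+ 2 :> R by rewrite mulrn_wge0 // pi_ge0.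
  have := goursat (hol_expc hf) x 0 yx0 p0.
  rewrite /rectint (addrC x) subrK add0r.
  have -> : (fun t => f (expc (t +i* (pi *+ 2)))) = (fun t => f (expc (t +i* 0))).
    by apply/funext => t; rewrite /expc /= cos2pi sin2pi cos0 sin0.
  have rg (p q r : C) : p + 'i * q - p - 'i * r = 'i * (q - r) by ring.
  rewrite rg => /eqP.
  rewrite mulf_eq0 => /orP[|].
    by rewrite eq_complex /= oner_eq0 andbF.
  by rewrite subr_eq0 => /eqP.
by have [a0|/ltW a0] := leP a 0; [exact: main|symmetry; exact: main].
Qed.

Lemma circ_inv f : hol f -> circ (fun x => f x^-1) = circ f.
Proof.
move=> hf; rewrite /circ; have cf := @hol_ccont _ 0 hf.
have := cint_aff (-1) (pi *+ 2) 0 (pi *+ 2) cf.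
rewrite mulr0 add0r mulN1r addNr.
have -> : (fun t => (-1)%:C * f (expc (0 +i* (-1 * t + pi *+ 2)))) =
          (fun t => -1 * f (expc (0 +i* t))^-1).
  apply/funext => t; rewrite mulN1r expc_period -expcN; congr (_ * f (expc _)).
    by simpc.
  by simpc.
rewrite cintZ; last first.
  have -> : (fun t => f (expc (0 +i* t))^-1) = (fun t => 1%:C * f (expc (0 +i* t))^-1).
    by apply/funext => t; rewrite mul1r.
  have hi : hol (fun x => f x^-1).
    by move=> z z0; apply: cdiff_comp; [exact: cdiffV|apply: hf; rewrite invr_eq0].
  apply: ccontZ; exact: (@hol_ccont _ 0 hi).
rewrite mulN1r => h; apply: oppr_inj; rewrite h.
have h1 := cint_chasles 0 (pi *+ 2) 0 cf; have h2 := cint_chasles 0 0 0 cf.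
have h0 : cint (fun t => f (expc (0 +i* t))) 0 0 = 0
  by apply: (addrI (cint (fun t => f (expc (0 +i* t))) 0 0)); rewrite h2 addr0.
by apply/eqP; rewrite -addr_eq0 addrC h1 h0.
Qed.

(** The Laurent coefficient of x^k, up to a factor 2 pi. *)
Definition ell (k : int) (f : C -> C) : C := circ (fun x => x ^ (- k) * f x).

Lemma hol_expfM (k : int) f : hol f -> hol (fun x => x ^ k * f x).
Proof. by move=> hf z z0; apply: cdiffM; [exact: cdiff_exprz|exact: hf]. Qed.

Lemma eq_ell k f g : (forall x, x != 0 -> f x = g x) -> ell k f = ell k g.
Proof. by move=> fg; apply: eq_circ => x x0; rewrite fg. Qed.

Lemma ellD k f g : hol f -> hol g -> ell k (fun x => f x + g x) = ell k f + ell k g.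
Proof.
move=> hf hg; rewrite /ell -circD; [|exact: hol_expfM|exact: hol_expfM].
by apply: eq_circ => x _; rewrite mulrDr.
Qed.

Lemma ellZ k c f : hol f -> ell k (fun x => c * f x) = c * ell k f.
Proof.
move=> hf; rewrite /ell -circZ; last exact: hol_expfM.
by apply: eq_circ => x _; rewrite mulrCA.
Qed.

Lemma ell_shift k (j : int) f : ell k (fun x => x ^ j * f x) = ell (k - j) f.
Proof.
apply: eq_circ => x x0; rewrite mulrA -expfzDr //; congr (_ ^ _ * _).
by rewrite opprB addrC.
Qed.

Lemma ell_scale k f w : hol f -> w != 0 -> ell k (fun x => f (w * x)) = w ^ k * ell k f.
Proof.
move=> hf w0; have hk := hol_expfM (- k) hf.
rewrite /ell -(circ_scale hk w0) -circZ; last first.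
  move=> z z0; apply: (@cdiff_comp _ (fun x => x ^ (- k) * f x) (fun x => w * x)).
    by apply: cdiffM; [exact: cdiff_cst|exact: cdiff_id].
  by apply: hk; rewrite mulf_neq0.
apply: eq_circ => x x0; rewrite exprzMl ?unitfE // mulrA; congr (_ * _).
by rewrite mulrA -expfzDr // subrr expr0z mul1r.
Qed.

Lemma ell_inv k f : hol f -> ell k (fun x => f x^-1) = ell (- k) f.
Proof.
move=> hf; rewrite /ell opprK.
rewrite -(circ_inv (hol_expfM k hf)); apply: eq_circ => x x0.
by rewrite exprz_inv.
Qed.

(** On the unit circle this is (1 + cos t) / 2, a positive trigonometric
    polynomial with its maximum 1 at x = 1; its powers concentrate there. *)
Definition kern (x : C) : C := (2 + x + x^-1) / 4.
Definition tau (t : R) : R := (1 + cos t) / 2.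

Lemma kernE t : kern (expc (0 +i* t)) = (tau t)%:C.
Proof.
rewrite /kern -expcN /expc /= oppr0 expR0 cosN sinN !mul1r /tau.
rewrite rmorphM rmorphD rmorph1 /= fmorphV /= rmorph_nat.
have -> : cos t +i* sin t = (cos t)%:C + 'i * (sin t)%:C by simpc.
have -> : cos t +i* (- sin t) = (cos t)%:C - 'i * (sin t)%:C by simpc.
by field.
Qed.

Lemma hol_kern : hol kern.
Proof.
move=> z z0; apply: cdiffM; last exact: cdiff_cst.
apply: cdiffD; last exact: cdiffV.
by apply: cdiffD; [exact: cdiff_cst|exact: cdiff_id].
Qed.

Lemma holM f g : hol f -> hol g -> hol (fun x => f x * g x).
Proof. by move=> hf hg z z0; apply: cdiffM; [exact: hf|exact: hg]. Qed.
Lemma holD f g : hol f -> hol g -> hol (fun x => f x + g x).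
Proof. by move=> hf hg z z0; apply: cdiffD; [exact: hf|exact: hg]. Qed.
Lemma holZ c f : hol f -> hol (fun x => c * f x).
Proof. by move=> hf z z0; apply: cdiffM; [exact: cdiff_cst|exact: hf]. Qed.
Lemma holX f n : hol f -> hol (fun x => f x ^+ n).
Proof. by move=> hf z z0; apply: cdiffX; exact: hf. Qed.

(** The coefficients of f times a Laurent polynomial are combinations of those
    of f. *)
Lemma ell_kern f : hol f -> (forall k, ell k f = 0) ->
  forall n k, ell k (fun x => f x * kern x ^+ n) = 0.
Proof.
move=> hf f0; elim=> [|n IH] k.
  by rewrite -[RHS](f0 k); apply: eq_ell => x _; rewrite mulr1.
have hg : hol (fun x => f x * kern x ^+ n) by apply: holM => //; apply/holX/hol_kern.
rewrite (@eq_ell k _ (fun x => 2^-1 * (f x * kern x ^+ n) +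
    (4^-1 * (x ^ 1 * (f x * kern x ^+ n)) + 4^-1 * (x ^ (-1) * (f x * kern x ^+ n))))).
  rewrite !ellD ?ellZ ?ell_shift ?IH ?mulr0 ?addr0 //;
    by repeat (first [apply: holD|apply: holZ|apply: hol_expfM]).
move=> x x0; rewrite exprS expr1z exprN1 {1}/kern; field.
exact: x0.
Qed.

Definition wallis (n : nat) : R := rint (fun t => tau t ^+ n) 0 (pi *+ 2).

Lemma sin2_tau t : sin t ^+ 2 = 4 * tau t * (1 - tau t).
Proof. by rewrite sin2cos2 /tau; field. Qed.

Lemma is_derive_tau (t : R) : is_derive t 1 tau (- sin t / 2).
Proof.
rewrite (_ : tau = 2^-1 \*: (cst 1 + @cos R)); last first.
  by apply/funext => s; rewrite /tau mulrC.
have h := is_deriveZ 2^-1 (is_deriveD (is_derive_cst (1 : R) t 1) (is_derive_cos t)).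
by apply: (is_derive_eq h); rewrite /GRing.scale /= add0r mulrC.
Qed.

Lemma fct_expr (h : R -> R) n t : (h ^+ n) t = h t ^+ n.
Proof. by elim: n => [|n IH]; rewrite ?expr0 // !exprS -IH. Qed.

(** Integrate the derivative of sin t * tau^n, and use sin^2 = 4 tau (1 - tau). *)
Lemma wallisS n : (2 * n.+1)%:R * wallis n.+1 = (2 * n + 1)%:R * wallis n.
Proof.
pose G := (@sin R) * (tau ^+ n : R -> R).
have dG (t : R) : is_derive t 1 G ((2 * n.+1)%:R * tau t ^+ n.+1 + - (2 * n + 1)%:R * tau t ^+ n).
  have h := is_deriveM (is_derive_sin t) (is_deriveX n (is_derive_tau t)).
  apply: (is_derive_eq h); rewrite /GRing.scale /=.
  have ct : cos t = 2 * tau t - 1 by rewrite /tau; field.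
  rewrite fct_expr.
  case: n {G h} => [|n]; first by rewrite ct; ring.
  rewrite ct /= !natrM !natrD !natrM -(natr1 n.+1) !exprS.
  have -> : forall x : R, sin t * (x * tau t ^+ n * (- sin t / 2)) = - x / 2 * tau t ^+ n * sin t ^+ 2.
    by move=> x; field.
  by rewrite sin2_tau; field.
have dW m (t : R) : exists2 F : R -> R, F (pi *+ 2) - F 0 = wallis m & forall t : R, is_derive t 1 F (tau t ^+ m).
  have ct : continuous tau by exact: der_cont is_derive_tau.
  have [|F dF] := @exists_primitive R (fun t => tau t ^+ m).
    by move=> s; exact: (@continuous_comp R R R tau (fun x => x ^+ m) s (ct s) (@exprn_continuous _ m _)).
  by exists F => //; rewrite /wallis (rintE _ _ dF).
have [F FE dF] := dW n.+1 0; have [H HE dH] := dW n 0.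
have := is_derive_0_is_cst (f := G - ((2 * n.+1)%:R \*: F + - (2 * n + 1)%:R \*: H)) (pi *+ 2) 0.
have d0 (t : R) : is_derive t 1 (G - ((2 * n.+1)%:R \*: F + - (2 * n + 1)%:R \*: H)) 0.
  have h := is_deriveB (dG t) (is_deriveD (is_deriveZ (2 * n.+1)%:R (dF t)) (is_deriveZ (- (2 * n + 1)%:R) (dH t))).
  by apply: (is_derive_eq h); rewrite subrr.
move=> /(_ d0); rewrite /G !fctE /= sin2pi sin0 !mul0r !sub0r -FE -HE /GRing.scale /=.
lra.
Qed.

Lemma wallis_gt0 n : 0 < wallis n.
Proof.
elim: n => [|n IH].
  rewrite /wallis (_ : (fun t => _) = cst 1); last by apply/funext => t; rewrite expr0.
  by rewrite (rintE _ _ (fun t => is_derive_id t 1)) subr0 mulrn_wgt0 // pi_gt0.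
have := wallisS n; rewrite -(@pmulr_rgt0 _ (2 * n.+1)%:R) ?ltr0n ?muln_gt0 // => ->.
by rewrite mulr_gt0 // ltr0n addn1.
Qed.

Lemma circ_kern n : circ (fun x => kern x ^+ n) = (wallis n)%:C.
Proof.
rewrite /circ.
have -> : (fun t => kern (expc (0 +i* t)) ^+ n) = (fun t => (tau t ^+ n)%:C).
  by apply/funext => t; rewrite kernE rmorphXn.
rewrite /cint.
rewrite /= /wallis; congr (_ +i* _).
by rewrite (@rintE _ (cst 0) (fun=> 0)) ?subrr // => t; exact: is_derive_cst.
Qed.

Lemma normc_expc1 (t : R) : normc (expc (0 +i* t) - 1) ^+ 2 = 4 * (1 - tau t).
Proof.
rewrite /expc /= expR0 mul1r; simpc; rewrite /= sqr_sqrtr ?addr_ge0 ?sqr_ge0 //.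
rewrite -/(_ ^+ 2); have := cos2Dsin2 t; rewrite /tau => h.
have -> : 4 * (1 - (1 + cos t) / 2) = 2 - 2 * cos t by field.
rewrite -[2 in RHS]/(1 + 1) -{2}h; ring.
Qed.

(** If f 1 = 1, then Re f >= 1/2 - K (1 - tau) on the whole circle for some K:
    near 1 by continuity, elsewhere because 1 - tau is bounded below.  Against
    tau^n this gives 0 >= wallis n / 2 - K (wallis n - wallis n.+1), whereas
    wallis n - wallis n.+1 = wallis n / (2 n + 2) is much smaller than wallis n. *)
Theorem ell_unique1 f : hol f -> (forall k, ell k f = 0) -> f 1 = 0.
Proof.
move=> hf f0; apply/eqP/negPn/negP => f1.
wlog {f1} f1 : f hf f0 / f 1 = 1.
  move=> H; apply: (H (fun x => (f 1)^-1 * f x)); first exact: holZ.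
    by move=> k; rewrite ellZ // f0 mulr0.
  by rewrite mulVf.
have [M M0 fM] : exists2 M : R, 0 <= M & forall t, 0 <= t <= pi *+ 2 -> - M <= Re (f (expc (0 +i* t))).
  have cf := ccont_Re (@hol_ccont _ 0 hf).
  have p0 : 0 <= pi *+ 2 :> R by rewrite mulrn_wge0 // pi_ge0.
  have [c _ h] := EVT_min p0 (continuous_subspaceT cf).
  exists `|Re (f (expc (0 +i* c)))| => // t tp.
  by rewrite (le_trans _ (h t _)) ?in_itv //= lerNl -normrN ler_norm.
have [d d0 fd] : exists2 d : R, 0 < d & forall w, normc (w - 1) < d -> 2^-1 <= Re (f w).
  have /contCP/(_ 2^-1) := cdiff_cont (hf 1 (oner_neq0 _)).
  rewrite invr_gt0 ltr0n => /(_ isT)/nbhsCP[d d0 h]; exists d => // w /h.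
  rewrite f1 => h1; have := le_lt_trans (Re_le _) h1.
  by rewrite raddfB /= ltr_norml => /andP[]; lra.
set K := 4 * (M + 1) / d ^+ 2.
have K0 : 0 <= K.
  by apply: divr_ge0; [apply: mulr_ge0 => //; exact: addr_ge0|exact: sqr_ge0].
have tau0 t : 0 <= tau t by rewrite /tau divr_ge0 // -lerBlDl sub0r cos_geN1.
have tau1 t : tau t <= 1 by rewrite /tau ler_pdivrMr // mul1r; have := cos_le1 t; lra.
have key t : 0 <= t <= pi *+ 2 -> 0 <= Re (f (expc (0 +i* t))) - 2^-1 + K * (1 - tau t).
  move=> tp; have t1 : 0 <= 1 - tau t by rewrite subr_ge0.
  have [h|h] := ltP (normc (expc (0 +i* t) - 1)) d.
    by apply: addr_ge0; [rewrite subr_ge0; exact: fd|exact: mulr_ge0].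
  have : d ^+ 2 <= 4 * (1 - tau t) by rewrite -normc_expc1 ler_pXn2r // nnegrE ?normc_ge0 // ltW.
  move=> h2; have : M + 1 <= K * (1 - tau t).
    rewrite /K mulrAC ler_pdivlMr ?exprn_gt0 //; nra.
  have := fM t tp; lra.
have ineq n : 0 <= (- 2^-1 + K) * wallis n - K * wallis n.+1.
  pose g x := f x * kern x ^+ n + ((- 2^-1 + K)%:C * kern x ^+ n + (- K)%:C * kern x ^+ n.+1).
  have hk m : hol (fun x => kern x ^+ m) by exact: holX hol_kern.
  have gE : circ g = ((- 2^-1 + K) * wallis n - K * wallis n.+1)%:C.
    rewrite /g !circD ?circZ ?circ_kern //;
      try by repeat (first [exact: hk|exact: hf|apply: holD|apply: holZ|apply: holM]).
    have -> : circ (fun x => f x * kern x ^+ n) = 0.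
      rewrite -(ell_kern hf f0 n 0); apply: eq_circ => x _.
      by rewrite oppr0 expr0z mul1r.
    by rewrite add0r -!rmorphM -rmorphD mulNr.
  have hg : hol g by apply: holD; [exact: holM|apply: holD; exact: holZ].
  suff : 0 <= Re (circ g) by rewrite gE.
  apply: cint_ge0; first exact: hol_ccont.
    by rewrite mulrn_wge0 // pi_ge0.
  move=> t tp; have := key t tp; rewrite /g !kernE; case: (f _) => u v /= kt.
  have -> : (u +i* v) * (tau t)%:C ^+ n + ((- 2^-1 + K)%:C * (tau t)%:C ^+ n +
      (- K)%:C * (tau t)%:C ^+ n.+1) = (u +i* v) * (tau t ^+ n)%:C +
      ((- 2^-1 + K) * tau t ^+ n + - K * tau t ^+ n.+1)%:C.
    have rX m : (tau t)%:C ^+ m = (tau t ^+ m)%:C by rewrite rmorphXn.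
    rewrite !rX; congr (_ + _).
    by simpc.
  rewrite (_ : complex.Re _ = (u - 2^-1 + K * (1 - tau t)) * tau t ^+ n); last first.
    by rewrite /= exprS; ring.
  by apply: mulr_ge0 => //; exact: exprn_ge0.
(* any n with n + 1 > K gives the contradiction *)
have [n hn] : exists n : nat, K < n%:R by exists (Num.bound K); exact: archi_boundP.
have := ineq n; have w0 := wallis_gt0 n; have := wallisS n.
rewrite !natrM natrD natrM => e h.
have n1 : 0 < n%:R + 1 :> R by rewrite ltr_wpDl // ler0n.
have e1 : wallis n.+1 = (2 * n%:R + 1) / (2 * (n%:R + 1)) * wallis n.
  apply: (mulfI (_ : 2 * (n.+1)%:R != 0 :> R)); first by rewrite mulf_neq0 // pnatr_eq0.
  rewrite e -[n.+1]addn1 natrD; field.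
  by rewrite gt_eqF.
move: h; rewrite e1.
have -> : (- 2^-1 + K) * wallis n - K * ((2 * n%:R + 1) / (2 * (n%:R + 1)) * wallis n) =
   wallis n / 2 * ((K - (n%:R + 1)) / (n%:R + 1)).
  by field; rewrite gt_eqF.
rewrite pmulr_rge0 ?divr_gt0 // ler_pdivlMr // mul0r subr_ge0; lra.
Qed.

Theorem ell_unique f : hol f -> (forall k, ell k f = 0) -> forall x, x != 0 -> f x = 0.
Proof.
move=> hf f0 x x0; rewrite -[x]mulr1.
apply: (@ell_unique1 (fun y => f (x * y))) => [z z0|k].
  apply: (@cdiff_comp _ f (fun y => x * y)).
    by apply: cdiffM; [exact: cdiff_cst|exact: cdiff_id].
  by apply: hf; rewrite mulf_neq0.
by rewrite ell_scale // f0 mulr0.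
Qed.

End Fourier.

(** * Limits of complex sequences *)

Section Seq.
Local Open Scope classical_set_scope.
Local Open Scope complex_scope.
Import ComplexField.Normc.
Variable R : realType.
Notation C := R[i].
Notation Re := (@complex.Re R).
Notation Im := (@complex.Im R).

Definition clim (u : nat -> C) (l : C) := (u : nat -> C^o) @ \oo --> (l : C^o).

Lemma climP u l : clim u l <-> forall e : R, 0 < e -> \forall n \near \oo, normc (u n - l) < e.
Proof.
split=> [h e e0|h].
  move/(@cvgrPdist_lt _ C^o) : h => /(_ e%:C); rewrite ltcR => /(_ e0).
  by apply: filterS => y; rewrite normE ltcR normcC.
apply/(@cvgrPdist_lt _ C^o) => e e0.
have [k ek] : exists k, e = k%:C.
  by exists (Re e); case: e e0 => a b; rewrite ltcE /= => /andP[/eqP-> _].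
move: e0; rewrite ek ltcR => /h; apply: filterS => y.
by rewrite normE ltcR normcC.
Qed.

Lemma clim_lim u l : clim u l -> limn (u : nat -> C^o) = l.
Proof. by move=> h; apply: cvg_lim => //; exact: norm_hausdorff. Qed.

Lemma clim_unique u l l' : clim u l -> clim u l' -> l = l'.
Proof. by move=> /clim_lim <- /clim_lim <-. Qed.

Lemma climD u v l m : clim u l -> clim v m -> clim (fun n => u n + v n) (l + m).
Proof. exact: (@cvgD _ C^o). Qed.

Lemma climM u v l m : clim u l -> clim v m -> clim (fun n => u n * v n) (l * m).
Proof. exact: (@cvgM C). Qed.

Lemma clim_cst c : clim (fun=> c) c.
Proof. exact: (@cvg_cst C^o). Qed.

Lemma clim_subseq u l (g : nat -> nat) : clim u l -> (forall n, (n <= g n)%N) ->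
  clim (fun n => u (g n)) l.
Proof.
move=> /climP h hg; apply/climP => e e0; have [N _ hN] := h e e0.
by exists N => // n /= Nn; apply: hN => /=; exact: leq_trans Nn (hg n).
Qed.

Lemma clim_le u l M : clim u l -> (forall n, normc (u n) <= M) -> normc l <= M.
Proof.
move=> /climP h uM; apply/ler_addgt0Pr => e e0; have [N _ /(_ N (leqnn N)) hN] := h e e0.
have -> : l = u N - (u N - l) by ring.
by rewrite (le_trans (normcB _ _)) // lerD // ltW.
Qed.

Lemma clim_ge u l M : clim u l -> (forall n, M <= normc (u n)) -> M <= normc l.
Proof.
move=> /climP h uM; apply/ler_addgt0Pr => e e0; have [N _ /(_ N (leqnn N)) hN] := h e e0.
rewrite (le_trans (uM N)) //; have -> : u N = l + (u N - l) by ring.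
by rewrite (le_trans (le_normcD _ _)) // lerD // ltW.
Qed.

Lemma real_geom_cvg (u : nat -> R) (B r : R) : 0 <= r < 1 ->
  (forall n, `|u n.+1 - u n| <= B * r ^+ n) -> cvgn u.
Proof.
move=> /andP[r0 r1] hu.
have cs : cvgn (series (fun n => u n.+1 - u n)).
  apply: normed_cvg; apply: (series_le_cvg (v_ := geometric B r)) => [n|n|n|].
  - exact: normr_ge0.
  - exact: le_trans (hu n).
  - exact: hu.
  - by apply: is_cvg_geometric_series; rewrite ger0_norm.
have -> : u = (fun n => series (fun n => u n.+1 - u n) n + u 0).
  by apply/funext => n; rewrite /series /= telescope_sumr // subrK.
by apply: is_cvgD => //; exact: is_cvg_cst.
Qed.

Lemma geom_clim (u : nat -> C) (B r : R) : 0 <= r < 1 ->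
  (forall n, normc (u n.+1 - u n) <= B * r ^+ n) -> exists l, clim u l.
Proof.
move=> r01 hu.
have /cvg_ex[/= a ca] : cvgn (fun n => Re (u n)).
  by apply: (real_geom_cvg r01) => n; rewrite -raddfB (le_trans (Re_le _)) // hu.
have /cvg_ex[/= b cb] : cvgn (fun n => Im (u n)).
  by apply: (real_geom_cvg r01) => n; rewrite -raddfB (le_trans (Im_le _)) // hu.
exists (a +i* b); apply/climP => e e0; have e2 : 0 < e / 2 by rewrite divr_gt0.
near=> n; rewrite (le_lt_trans (normc_le _)) // [e]splitr !raddfB ltrD //= distrC; near: n.
  by move/cvgrPdist_lt: ca; apply.
by move/cvgrPdist_lt: cb; apply.
Unshelve. all: by end_near. Qed.

Lemma cdiff_quad (f : C -> C) z d B : (forall h, normc h <= 1 ->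
  normc (f (z + h) - f z - d * h) <= B * normc h ^+ 2) -> cdiff f z.
Proof.
move=> hB; exists (fun w => if w == z then d else (f w - f z) / (w - z)); last first.
  move=> w; case: eqVneq => [->|wz]; first by rewrite subrr mulr0 addr0.
  by rewrite divfK ?subr_eq0 // addrC subrK.
apply/contCP => e e0; rewrite eqxx.
have B0 : 0 <= B.
  by have := hB 1; rewrite normc1 => /(_ (lexx _)); rewrite expr1n !mulr1 => h; exact: le_trans (normc_ge0 _) h.
apply/nbhsCP; exists (Num.min 1 (e / (B + 1))).
  by rewrite lt_min ltr01 divr_gt0 // ltr_wpDl.
move=> w; rewrite lt_min => /andP[w1 we]; case: eqVneq => [_|wz]; first by rewrite subrr normc0.
have n0 : 0 < normc (w - z) by rewrite normc_gt0 subr_eq0.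
have := hB (w - z) (ltW w1); rewrite [z + _]addrC subrK => h.
have -> : (f w - f z) / (w - z) - d = (f w - f z - d * (w - z)) / (w - z).
  by field; rewrite subr_eq0.
rewrite normcM normcV ltr_pdivrMr // (le_lt_trans h) // expr2 mulrA ltr_pM2r //.
move: we; rewrite ltr_pdivlMr ?ltr_wpDl // mulrC mulrDl mul1r; apply: le_lt_trans.
by rewrite lerDl normc_ge0.
Qed.

End Seq.

(** * The infinite product *)

Section QPoch.
Local Open Scope classical_set_scope.
Local Open Scope complex_scope.
Import ComplexField.Normc.
Variable R : realType.
Notation C := R[i].
Variable q : C.
Hypothesis q1 : normc q < 1.
Let r := normc q.
Let r0 : 0 <= r. Proof. exact: normc_ge0. Qed.
Let s0 : 0 < 1 - r. Proof. by rewrite subr_gt0. Qed.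

Definition qprod (a : C) (N : nat) : C := \prod_(0 <= j < N) (1 - a * q ^+ j).

Lemma qprodS a N : qprod a N.+1 = qprod a N * (1 - a * q ^+ N).
Proof. by rewrite /qprod big_nat_recr. Qed.

Lemma qprodSl a N : qprod a N.+1 = (1 - a) * qprod (a * q) N.
Proof.
rewrite /qprod big_nat_recl //= expr0 mulr1; congr (_ * _).
by apply: eq_bigr => j _; rewrite exprS mulrA.
Qed.

(** [qprod (a + h)] is [qprod a + qprod1 a * h + qprod2 a h * h^2]; the recursive
    form allows a bound that is uniform in N. *)
Fixpoint qprod1 a N : C := if N is n.+1 then
  qprod1 a n * (1 - a * q ^+ n) - q ^+ n * qprod a n else 0.
Fixpoint qprod2 a h N : C := if N is n.+1 then
  qprod2 a h n * (1 - (a + h) * q ^+ n) - q ^+ n * qprod1 a n else 0.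

Lemma qprod_taylor a h N :
  qprod (a + h) N = qprod a N + qprod1 a N * h + qprod2 a h N * h ^+ 2.
Proof.
elim: N => [|n IH]; first by rewrite /qprod !big_geq //=; ring.
rewrite !qprodS IH /=; ring.
Qed.

Let bnd a := expR ((normc a + 1) / (1 - r)).

(** The sum of the three moduli is multiplied by at most
    1 + (|a| + 1) |q|^N at step N, and the product of these factors converges. *)
Lemma qprod_bound a h N : normc h <= 1 ->
  normc (qprod a N) + normc (qprod1 a N) + normc (qprod2 a h N) <= bnd a.
Proof.
move=> h1; set S := fun n => normc (qprod a n) + normc (qprod1 a n) + normc (qprod2 a h n).
set K := normc a + 1; have K0 : 0 <= K by rewrite addr_ge0 ?normc_ge0.
have SS n : S n.+1 <= S n * (1 + K * r ^+ n).
  rewrite /S qprodS /=; set f := qprod a n; set d := qprod1 a n; set e := qprod2 a h n.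
  have rn : normc (q ^+ n) = r ^+ n by rewrite normcX.
  have rn0 : 0 <= r ^+ n by exact: exprn_ge0.
  have b1 : normc (f * (1 - a * q ^+ n)) <= normc f + normc f * normc a * r ^+ n.
    have -> : f * (1 - a * q ^+ n) = f - f * a * q ^+ n by ring.
    by rewrite (le_trans (normcB _ _)) // !normcM rn.
  have b2 : normc (d * (1 - a * q ^+ n) - q ^+ n * f) <= normc d + normc d * normc a * r ^+ n + r ^+ n * normc f.
    have -> : d * (1 - a * q ^+ n) - q ^+ n * f = d - d * a * q ^+ n - q ^+ n * f by ring.
    rewrite (le_trans (normcB _ _)) // !normcM rn lerD2r (le_trans (normcB _ _)) //.
    by rewrite !normcM rn.
  have b3 : normc (e * (1 - (a + h) * q ^+ n) - q ^+ n * d) <= normc e + normc e * K * r ^+ n + r ^+ n * normc d.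
    have -> : e * (1 - (a + h) * q ^+ n) - q ^+ n * d = e - e * (a + h) * q ^+ n - q ^+ n * d by ring.
    rewrite (le_trans (normcB _ _)) // !normcM rn lerD2r (le_trans (normcB _ _)) //.
    rewrite !normcM rn lerD2l ler_wpM2r // ler_wpM2l ?normc_ge0 //.
    by rewrite (le_trans (le_normcD _ _)) // lerD2l.
  have e0 : 0 <= normc e * r ^+ n by rewrite mulr_ge0 ?normc_ge0.
  apply: (le_trans (lerD (lerD b1 b2) b3)); rewrite /K -subr_ge0.
  rewrite (_ : _ - _ = 0) //; ring.
suff H n : S n <= expR (K * ((1 - r ^+ n) / (1 - r))).
  apply: (le_trans (H N)); rewrite ler_expR ler_wpM2l // ler_piMl ?invr_ge0 ?(ltW s0) //.
  by rewrite gerBl exprn_ge0.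
elim: n => [|n IH].
  by rewrite /S /qprod big_geq // [qprod1 a 0]/(0 : C) [qprod2 a h 0]/(0 : C) normc0 normc1 !addr0 subrr mul0r mulr0 expR0.
have -> : K * ((1 - r ^+ n.+1) / (1 - r)) = K * ((1 - r ^+ n) / (1 - r)) + K * r ^+ n.
  by rewrite exprS; field; rewrite gt_eqF.
rewrite expRD (le_trans (SS n)) // ler_pM //.
- by rewrite !addr_ge0 ?normc_ge0.
- by rewrite addr_ge0 // mulr_ge0 // exprn_ge0.
- exact: expR_ge1Dx.
Qed.

Let normc0_le1 : normc (0 : C) <= 1. Proof. by rewrite normc0 ler01. Qed.

Lemma qprod_clim a : clim (qprod a) (qpoch a q).
Proof.
have [||l cl] := @geom_clim R (qprod a) (normc a * bnd a) r; first by rewrite r0 q1.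
  move=> n; rewrite qprodS.
  have -> : qprod a n * (1 - a * q ^+ n) - qprod a n = - (a * qprod a n * q ^+ n) by ring.
  rewrite normcN !normcM normcX ler_wpM2r ?exprn_ge0 // ler_wpM2l ?normc_ge0 //.
  rewrite (le_trans _ (qprod_bound a n normc0_le1)) // -addrA lerDl addr_ge0 ?normc_ge0 //.
by rewrite /qpoch (clim_lim cl).
Qed.

(** A limit of differentiable functions whose second order remainders are bounded
    uniformly is differentiable; the derivatives converge as the values do. *)
Lemma cdiff_qpoch a : cdiff (fun a => qpoch a q) a.
Proof.
have bn h n : normc h <= 1 -> normc (qprod2 a h n) <= bnd a.
  by move=> /(qprod_bound a n); apply: le_trans; rewrite lerDr addr_ge0 ?normc_ge0.
have b1 n : normc (qprod1 a n) <= bnd a.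
  by rewrite (le_trans _ (qprod_bound a n normc0_le1)) // addrAC lerDr addr_ge0 ?normc_ge0.
have b0 n : normc (qprod a n) <= bnd a.
  by rewrite (le_trans _ (qprod_bound a n normc0_le1)) // -addrA lerDl addr_ge0 ?normc_ge0.
have [||d cd] := @geom_clim R (qprod1 a) ((normc a + 1) * bnd a) r; first by rewrite r0 q1.
  move=> n /=.
  have -> : qprod1 a n * (1 - a * q ^+ n) - q ^+ n * qprod a n - qprod1 a n =
    - ((a * qprod1 a n + qprod a n) * q ^+ n) by ring.
  rewrite normcN !normcM normcX ler_wpM2r ?exprn_ge0 //.
  rewrite (le_trans (le_normcD _ _)) // normcM mulrDl mul1r lerD // ler_wpM2l ?normc_ge0 //.
apply: (@cdiff_quad _ _ _ d (bnd a)) => h h1.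
apply: (@clim_le _ (fun n => qprod (a + h) n + -1 * qprod a n + - h * qprod1 a n)).
  have -> : qpoch (a + h) q - qpoch a q - d * h = qpoch (a + h) q + -1 * qpoch a q + - h * d by ring.
  apply: climD; first apply: climD; first exact: qprod_clim.
    by apply: climM; [exact: clim_cst|exact: qprod_clim].
  by apply: climM; [exact: clim_cst|exact: cd].
move=> n; rewrite qprod_taylor.
have -> : qprod a n + qprod1 a n * h + qprod2 a h n * h ^+ 2 + -1 * qprod a n + - h * qprod1 a n
  = qprod2 a h n * h ^+ 2 by ring.
by rewrite normcM normcX ler_wpM2r ?exprn_ge0 ?normc_ge0 // bn.
Qed.

Lemma qpochS a : qpoch a q = (1 - a) * qpoch (a * q) q.
Proof.
apply: (@clim_unique _ (fun n => qprod a n.+1)).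
  by apply: (@clim_subseq _ (qprod a) _ S); [exact: qprod_clim|exact: leqnSn].
rewrite (_ : (fun n => _) = (fun n => (1 - a) * qprod (a * q) n)).
  by apply: climM; [exact: clim_cst|exact: qprod_clim].
by apply/funext => n; rewrite qprodSl.
Qed.

Lemma qpochN a N : qpoch a q = qprod a N * qpoch (a * q ^+ N) q.
Proof.
elim: N => [|N IH]; first by rewrite /qprod big_geq // mul1r mulr1.
by rewrite IH qprodS qpochS exprSr !mulrA.
Qed.

(** For a product of numbers 1 - t_j, the modulus is at least 1 - sum |t_j|. *)
Lemma qpoch_small a : normc a <= (1 - r) / 2 -> qpoch a q != 0.
Proof.
move=> ha; rewrite -normc_gt0; suff low n : (2^-1 : R) <= normc (qprod a n).
  by apply: lt_le_trans (clim_ge (@qprod_clim a) low); rewrite invr_gt0.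
have ha1 : normc a <= 1 by apply: (le_trans ha); rewrite ler_pdivrMr //; move: r0; lra.
have rn m : 0 <= r ^+ m <= 1 by rewrite exprn_ge0 //= exprn_ile1 // ltW.
suff H m : 1 - normc a * ((1 - r ^+ m) / (1 - r)) <= normc (qprod a m).
  apply: (le_trans _ (H n)); rewrite lerBrDr -lerBrDl.
  have -> : 1 - 2^-1 = 2^-1 :> R by field.
  rewrite mulrA ler_pdivrMr //; have := rn n; move: (normc_ge0 a) ha; nra.
elim: m => [|m IH]; first by rewrite /qprod big_geq // normc1 subrr mul0r mulr0 subr0.
rewrite qprodS normcM.
have e1 : 1 - normc a * r ^+ m <= normc (1 - a * q ^+ m).
  rewrite lerBlDr; have {1}-> : (1 : R) = normc (1 - a * q ^+ m + a * q ^+ m) by rewrite subrK normc1.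
  by rewrite (le_trans (le_normcD _ _)) // lerD2l normcM normcX.
have -> : (1 - r ^+ m.+1) / (1 - r) = (1 - r ^+ m) / (1 - r) + r ^+ m.
  by rewrite exprS; field; rewrite gt_eqF.
set x := _ / _ in IH *; set y := r ^+ m in e1 *.
have x0 : 0 <= x by rewrite divr_ge0 // ?(ltW s0) // subr_ge0; case/andP: (rn m).
have y01 := rn m; rewrite -/y in y01; case/andP: y01 => y0 y1.
have ay : normc a * y <= 1 by rewrite mulr_ile1 ?normc_ge0.
have a0 := normc_ge0 a.
apply: (le_trans _ (ler_wpM2l (normc_ge0 _) e1)).
have := ler_wpM2r (_ : 0 <= 1 - normc a * y) IH; rewrite subr_ge0 => /(_ ay); apply: le_trans.
have : 0 <= normc a * x * (normc a * y) by apply: mulr_ge0; apply: mulr_ge0.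
lra.
Qed.

(** Far enough in the product, [qpoch_small] applies to the remaining factors. *)
Lemma qpoch_eq0 a : qpoch a q = 0 <-> exists j : nat, a * q ^+ j = 1.
Proof.
split=> [h|[j h]]; last first.
  by rewrite (qpochN a j.+1) qprodS h subrr mulr0 mul0r.
have [N hN] : exists N, normc (a * q ^+ N) <= (1 - r) / 2.
  have e0 : 0 < (1 - r) / 2 / (normc a + 1).
    by rewrite !divr_gt0 // ltr_wpDl ?normc_ge0.
  have : (r ^+ n) @[n --> \oo] --> (0 : R) by apply: cvg_expr; rewrite ger0_norm.
  move/cvgrPdist_lt => /(_ _ e0)[N _ /(_ N (leqnn N))] /=.
  rewrite sub0r normrN ger0_norm ?exprn_ge0 // => /ltW hN; exists N.
  rewrite normcM normcX -/r; move: hN; rewrite ler_pdivlMr ?ltr_wpDl ?normc_ge0 //.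
  by apply: le_trans; rewrite mulrDr mulr1 mulrC lerDl exprn_ge0.
move: h; rewrite (qpochN a N) => /eqP; rewrite mulf_eq0 (negbTE (qpoch_small hN)) orbF.
rewrite /qprod prodf_seq_eq0 => /hasP[j _ /=]; rewrite subr_eq0 => /eqP e.
by exists j.
Qed.

End QPoch.

(** * Alternating functions on spaces of bounded dimension *)

Section AltProd.
Variable F : numFieldType.

(** A permutation acts on the pairs i < j once its image is put back in order,
    which a symmetric factor does not notice. *)
Lemma sym_prod n (w : 'I_n -> 'I_n -> F) (s : 'S_n) : (forall i j, w i j = w j i) ->
  \prod_(i < n) \prod_(j < n | (i < j)%N) w (s i) (s j) =
  \prod_(i < n) \prod_(j < n | (i < j)%N) w i j.
Proof.
move=> ws; rewrite !pair_big_dep /=.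
pose h (s : 'S_n) (q : 'I_n * 'I_n) := if (s q.1 < s q.2)%N then (s q.1, s q.2) else (s q.2, s q.1).
have hK (t : 'S_n) (q : 'I_n * 'I_n) : (q.1 < q.2)%N -> h t^-1%g (h t q) = q.
  case: q => a b /= ab; rewrite /h; case: (ltnP (t a) (t b)) => _ /=; rewrite !permK.
    by rewrite ab.
  by rewrite ltnNge (ltnW ab).
have hlt (t : 'S_n) (q : 'I_n * 'I_n) : (q.1 < q.2)%N -> ((h t q).1 < (h t q).2)%N.
  case: q => a b /= ab; rewrite /h /=; case: (ltngtP (t a) (t b)) => //= e.
  by move: ab; rewrite (perm_inj (val_inj e)) ltnn.
rewrite [RHS](reindex_onto (h s) (h s^-1%g)) /=; last first.
  by move=> q lq; rewrite -{1}[s]invgK hK.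
apply: eq_big => [q|q lq]; last by rewrite /h; case: ifP.
apply/idP/andP => [lq|[h1 /eqP h2]]; first by rewrite hlt // hK.
by have := hlt s^-1%g _ h1; rewrite h2.
Qed.

(** Compare u with the differences of the indices: the quotient is symmetric,
    and the product of the differences is a Vandermonde determinant. *)
Lemma alt_prod n (u : F -> F -> F) (x : 'I_n -> F) (s : 'S_n) :
  (forall i j, u (x i) (x j) = - u (x j) (x i)) ->
  \prod_(i < n) \prod_(j < n | (i < j)%N) u (x (s i)) (x (s j)) =
  (-1) ^+ s * \prod_(i < n) \prod_(j < n | (i < j)%N) u (x i) (x j).
Proof.
move=> ua.
pose d (i j : 'I_n) : F := (j : nat)%:R - (i : nat)%:R.
pose w i j := u (x i) (x j) / d i j.
have ws i j : w i j = w j i by rewrite /w ua /d -[in RHS]opprB invrN mulrN mulNr.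
have d0 (i j : 'I_n) : (i < j)%N -> d i j != 0.
  by move=> ij; rewrite subr_eq0 eqr_nat gtn_eqF.
have dV (t : 'S_n) : \prod_(i < n) \prod_(j < n | (i < j)%N) d (t i) (t j) =
    \det (Vandermonde n (\row_j ((t j : nat)%:R : F))).
  rewrite det_Vandermonde; apply: eq_bigr => i _; apply: eq_bigr => j _.
  by rewrite !mxE.
have dS : \prod_(i < n) \prod_(j < n | (i < j)%N) d (s i) (s j) =
    (-1) ^+ s * \prod_(i < n) \prod_(j < n | (i < j)%N) d i j.
  have -> : \prod_(i < n) \prod_(j < n | (i < j)%N) d i j =
     \prod_(i < n) \prod_(j < n | (i < j)%N) d ((1%g : 'S_n) i) ((1%g : 'S_n) j).
    by apply: eq_bigr => i _; apply: eq_bigr => j _; rewrite !perm1.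
  rewrite !dV.
  have -> : Vandermonde n (\row_j (s j : nat)%:R) = col_perm s (Vandermonde n (\row_j ((1%g : 'S_n) j : nat)%:R) : 'M[F]_n).
    by apply/matrixP => i j; rewrite !mxE !perm1.
  by rewrite col_permE det_mulmx det_perm mulrC odd_permV.
have uE (t : 'S_n) : \prod_(i < n) \prod_(j < n | (i < j)%N) u (x (t i)) (x (t j)) =
   (\prod_(i < n) \prod_(j < n | (i < j)%N) w (t i) (t j)) *
   (\prod_(i < n) \prod_(j < n | (i < j)%N) d (t i) (t j)).
  rewrite -big_split; apply: eq_bigr => i _; rewrite -big_split; apply: eq_bigr => j ij /=.
  rewrite /w divfK // subr_eq0 eqr_nat; apply: contraTneq ij => e.
  by rewrite (perm_inj (val_inj e)) ltnn.
rewrite uE sym_prod // dS mulrCA; congr (_ * _).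
rewrite -big_split; apply: eq_bigr => i _; rewrite -big_split; apply: eq_bigr => j ij /=.
by rewrite /w divfK // d0.
Qed.

End AltProd.

Section Alternant.
Variables (C : numFieldType) (n : nat).

Definition upd (x : 'I_n -> C) (i : 'I_n) (t : C) : 'I_n -> C :=
  fun j => if j == i then t else x j.

Lemma upd_id x i : upd x i (x i) = x.
Proof. by apply/funext => j; rewrite /upd; case: eqP => // ->. Qed.

Lemma updE x i t : upd x i t i = t.
Proof. by rewrite /upd eqxx. Qed.

Lemma upd_neq0 x i t : (forall j, x j != 0) -> t != 0 -> forall j, upd x i t j != 0.
Proof. by move=> x0 t0 j; rewrite /upd; case: ifP. Qed.

(** A space of functions on C^*, closed under linear combinations and separated
    by n linear functionals: its dimension is at most n. *)
Definition dim_le (S : (C -> C) -> Prop) :=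
  [/\ S (fun=> 0), forall c f g, S f -> S g -> S (fun x => c * f x + g x) &
    exists L : (C -> C) -> 'I_n -> C,
     [/\ forall c f g k, S f -> S g -> L (fun x => c * f x + g x) k = c * L f k + L g k,
         forall k, L (fun=> 0) k = 0 &
         forall f, S f -> (forall k, L f k = 0) -> forall x, x != 0 -> f x = 0]].

Variable S : (C -> C) -> Prop.
Hypothesis dimS : dim_le S.

Lemma closed_sum (I : Type) (r : seq I) (P : pred I) (u : I -> C) (e : I -> C -> C) :
  (forall i, S (e i)) -> S (fun x => \sum_(i <- r | P i) u i * e i x).
Proof.
have [S0 SD _] := dimS; move=> Se; elim: r => [|i r IH].
  by rewrite (_ : (fun x => _) = (fun=> 0)) //; apply/funext => x; rewrite big_nil.
case Pi : (P i).
  rewrite (_ : (fun x => _) = (fun x => u i * e i x + \sum_(j <- r | P j) u j * e j x)).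
    exact: SD.
  by apply/funext => x; rewrite big_cons Pi.
rewrite (_ : (fun x => _) = (fun x => \sum_(j <- r | P j) u j * e j x)) //.
by apply/funext => x; rewrite big_cons Pi.
Qed.

(** The functions e_j are independent by their values at the nodes, hence a basis
    of the space, and the values at the nodes are coordinates. *)
Lemma eq0_at_nodes (e : 'I_n -> C -> C) (y : 'I_n -> C) f :
  (forall j, S (e j)) -> (forall i, y i != 0) -> (forall i j, i != j -> e j (y i) = 0) ->
  (forall j, e j (y j) != 0) ->
  S f -> (forall i, f (y i) = 0) -> forall x, x != 0 -> f x = 0.
Proof.
move=> Se y0 eD eN Sf fy.
have [S0 SD [L [LD L0 Linj]]] := dimS.
have Lsum (u : 'I_n -> C) k : L (fun x => \sum_j u j * e j x) k = \sum_j u j * L (e j) k.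
  elim: (index_enum _) => [|i r IH].
    rewrite big_nil (_ : (fun x => _) = (fun=> 0)) //; apply/funext => x.
    by rewrite big_nil.
  rewrite big_cons -IH -LD //; last by apply: closed_sum.
  by congr L; apply/funext => x; rewrite big_cons.
have ev (u : 'I_n -> C) i : \sum_j u j * e j (y i) = u i * e i (y i).
  by rewrite (bigD1 i) //= big1 ?addr0 // => j ji; rewrite eD ?mulr0 // eq_sym.
have uzero (u : 'I_n -> C) : (forall k, L (fun x => \sum_j u j * e j x) k = 0) -> forall j, u j = 0.
  move=> h j; have := Linj _ (closed_sum _ _ u Se) h (y j) (y0 j).
  by rewrite ev => /eqP; rewrite mulf_eq0 (negbTE (eN j)) orbF => /eqP.
pose M := \matrix_(j, k) L (e j) k.
have uM : M \in unitmx.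
  rewrite -row_free_unit; apply/inj_row_free => v vM.
  apply/rowP => j; rewrite mxE; apply: (uzero (fun j => v 0 j)) => k.
  have h : (v *m M) 0 k = 0 by rewrite vM mxE.
  rewrite Lsum -[RHS]h mxE; apply: eq_bigr => i _; by rewrite mxE.
pose v := \row_k L f k; pose u := v *m invmx M.
have fu x : x != 0 -> f x = \sum_j u 0 j * e j x.
  move=> x0; suff h : -1 * (\sum_j u 0 j * e j x) + f x = 0.
    by apply/eqP; rewrite -subr_eq0 addrC -mulN1r h.
  apply: (Linj (fun x => -1 * (\sum_j u 0 j * e j x) + f x)) => //.
    by apply: SD => //; exact: closed_sum.
  move=> k; rewrite LD //; last exact: closed_sum.
  rewrite Lsum mulN1r addrC; apply/eqP; rewrite subr_eq0; apply/eqP.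
  have : (u *m M) 0 k = v 0 k by rewrite /u mulmxKV.
  rewrite mxE [v 0 k]mxE => <-; apply: eq_bigr => j _; by rewrite [M _ _]mxE.
move=> x x0; rewrite fu // big1 // => j _.
have := fy j; rewrite fu // ev => /eqP; rewrite mulf_eq0 (negbTE (eN j)) orbF => /eqP ->.
by rewrite mul0r.
Qed.

Definition alternating (H : ('I_n -> C) -> C) :=
  forall x (s : 'S_n), (forall i, x i != 0) -> H (fun i => x (s i)) = (-1) ^+ s * H x.

Definition multi (H : ('I_n -> C) -> C) :=
  forall x i, (forall i, x i != 0) -> S (fun t => H (upd x i t)).

Lemma alternating_eq0 H x i j : alternating H -> (forall i, x i != 0) ->
  i != j -> x i = x j -> H x = 0.
Proof.
move=> aH x0 ij xij; have := aH x (tperm i j) x0.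
rewrite odd_tperm ij expr1 mulN1r.
have -> : (fun k => x (tperm i j k)) = x by apply/funext => k; case: tpermP => // ->.
move=> /eqP; rewrite eq_sym -subr_eq0 -opprD oppr_eq0 -mulr2n -mulr_natl mulf_eq0.
by rewrite pnatr_eq0 /= => /eqP.
Qed.

(** The functions D (y with y_j replaced by t) form a Lagrange basis at the nodes
    y_j, so H is determined by its values at the points with all coordinates among
    the nodes.  Alternation reduces these to the value at y. *)
Lemma multi_unique D H y : multi D -> alternating D -> multi H -> alternating H ->
  (forall i, y i != 0) -> D y != 0 -> H y = 0 -> forall x, (forall i, x i != 0) -> H x = 0.
Proof.
move=> mD aD mH aH y0 Dy Hy.
have ip f : S f -> (forall i, f (y i) = 0) -> forall x, x != 0 -> f x = 0.
  apply: (@eq0_at_nodes (fun j t => D (upd y j t)) y f) => // [j|i j ij|j]; first exact: mD.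
    apply: (@alternating_eq0 D _ i j) => //; first exact: upd_neq0.
    by rewrite updE /upd (negbTE ij).
  by rewrite upd_id.
suff main k x : (forall i, x i != 0) -> (forall i : 'I_n, (k <= i)%N -> exists j, x i = y j) -> H x = 0.
  by move=> x x0; apply: (main n) => // i; rewrite leqNgt ltn_ord.
elim: k x => [|k IH] x x0 xy.
  have [g gP] := fin_all_exists (fun i => xy i (leq0n i)).
  have -> : x = (fun i => y (g i)) by apply/funext.
  have [/injectiveP gi|/injectivePn[i [j ij gij]]] := boolP (injectiveb g).
    have -> : (fun i => y (g i)) = (fun i => y (perm gi i)) by apply/funext => i; rewrite permE.
    by rewrite aH // Hy mulr0.
  by apply: (@alternating_eq0 H _ i j) => //; rewrite gij.
have [kn|nk] := ltnP k n; last first.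
  by apply: IH => // i ki; have := leq_trans nk ki; rewrite leqNgt ltn_ord.
pose i0 := Ordinal kn; rewrite -[x](upd_id x i0).
apply: (ip (fun t => H (upd x i0 t))) => // [|j]; first exact: mH.
apply: IH; first exact: upd_neq0.
move=> i ki; have [->|ii] := eqVneq i i0; first by exists j; rewrite updE.
rewrite /upd (negbTE ii); apply: xy; rewrite ltn_neqAle ki andbT.
by apply: contraNneq ii => e; apply/eqP/val_inj.
Qed.

Lemma det_multi (G : 'I_n -> C -> C) : (forall j, S (G j)) ->
  multi (fun x => \det (\matrix_(i, j) G j (x i))).
Proof.
move=> SG x i x0.
rewrite (_ : (fun t => _) = (fun t => \sum_j cofactor (\matrix_(i, j) G j (x i)) i j * G j t)).
  exact: closed_sum.
apply/funext => t; rewrite (expand_det_row _ i); apply: eq_bigr => j _.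
rewrite mxE updE mulrC; congr (_ * _); rewrite /cofactor; congr (_ * \det _).
by apply/matrixP => k l; rewrite !mxE /upd eq_sym (negbTE (neq_lift _ _)).
Qed.

Lemma det_alternating (G : 'I_n -> C -> C) :
  alternating (fun x => \det (\matrix_(i, j) G j (x i))).
Proof.
move=> x s _; have -> : \matrix_(i, j) G j (x (s i)) = row_perm s (\matrix_(i, j) G j (x i)).
  by apply/matrixP => i j; rewrite !mxE.
by rewrite row_permE det_mulmx det_perm.
Qed.

(** This says that the n-th exterior power of a space of dimension n is a line. *)
Lemma multi_proportional (D E : ('I_n -> C) -> C) (x y : 'I_n -> C) : multi D -> alternating D -> multi E -> alternating E ->
  (forall i, x i != 0) -> (forall i, y i != 0) -> E x * D y = D x * E y.
Proof.
move=> mD aD mE aE; have [S0 SD _] := dimS.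
have half (u v : 'I_n -> C) : (forall i, u i != 0) -> (forall i, v i != 0) ->
    D v != 0 -> E u * D v = D u * E v.
  move=> u0 v0 Dv; pose H z := D v * E z + ((- E v) * D z + 0).
  have : H u = 0.
    apply: (multi_unique mD aD _ _ v0 Dv) => //.
    - by move=> z i z0; apply: (SD); [exact: mE|apply: (SD) => //; exact: mD].
    - move=> z s z0; rewrite /H (aE z s z0) (aD z s z0); move: (_ ^+ _) => e; ring.
    - by rewrite /H; ring.
  by rewrite /H addr0 mulNr => /eqP; rewrite subr_eq0 => /eqP h; rewrite mulrC h mulrC.
move=> x0 y0; have [Dy|Dy] := eqVneq (D y) 0; last exact: half.
have [Dx|Dx] := eqVneq (D x) 0; first by rewrite Dx Dy mulr0 mul0r.
by rewrite mulrC -(half y x y0 x0 Dx) mulrC.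
Qed.

Theorem alternant_det (D : ('I_n -> C) -> C) (G : 'I_n -> C -> C) (x y : 'I_n -> C) : multi D -> alternating D ->
  (forall j, S (G j)) -> (forall i, x i != 0) -> (forall i, y i != 0) ->
  \det (\matrix_(i, j) G j (x i)) * D y = D x * \det (\matrix_(i, j) G j (y i)).
Proof.
move=> mD aD SG x0 y0.
exact: (multi_proportional mD aD (det_multi SG) (@det_alternating G) x0 y0).
Qed.

End Alternant.

(** * The theta function *)

Section Theta.
Local Open Scope classical_set_scope.
Local Open Scope complex_scope.
Import ComplexField.Normc.
Variable R : realType.
Notation C := R[i].
Variable p : C.
Hypothesis p0 : p != 0.
Hypothesis p1 : normc p < 1.
Notation th x := (theta x p).

Lemma theta1 : th 1 = 0.
Proof. by rewrite /theta (qpochS p1 1) subrr !mul0r. Qed.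

Lemma theta_px x : x != 0 -> th (p * x) = - x^-1 * th x.
Proof.
move=> x0; rewrite /theta (qpochS p1 x) (qpochS p1 (p / (p * x))).
have -> : p / (p * x) * p = p / x by field; rewrite x0 p0.
rewrite (mulrC x p); field; rewrite x0 p0 //.
Qed.

Lemma thetaV x : x != 0 -> th x^-1 = - x^-1 * th x.
Proof.
move=> x0; rewrite -theta_px // /theta invrK.
have -> : p / (p * x) = x^-1 by field; rewrite x0 p0.
exact: mulrC.
Qed.

Lemma theta_div x y : x != 0 -> y != 0 -> th (x / y) = - (x / y) * th (y / x).
Proof.
move=> x0 y0; rewrite -[x / y]invf_div thetaV ?mulf_neq0 ?invr_eq0 // invf_div //.
Qed.

Lemma theta_eq0 x : th x = 0 <-> exists j : nat, x * p ^+ j = 1 \/ x = p ^+ j.+1.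
Proof.
split=> [/eqP|[j [h|h]]].
- rewrite mulf_eq0 => /orP[|] /eqP/(qpoch_eq0 p1)[j h]; exists j; [by left|right].
  have x0 : x != 0 by apply: contra_eq_neq h => ->; rewrite invr0 mulr0 mul0r eq_sym oner_neq0.
  by rewrite exprS -[x]mul1r -h; field.
- by rewrite /theta (_ : qpoch x p = 0) ?mul0r //; apply/(qpoch_eq0 p1); exists j.
- rewrite /theta (_ : qpoch (p / x) p = 0) ?mulr0 //; apply/(qpoch_eq0 p1); exists j.
  by rewrite h exprS; field; rewrite expf_neq0 // p0.
Qed.

Lemma theta_pX_eq0 x (j : nat) : x != 0 -> (th (p ^+ j * x) == 0) = (th x == 0).
Proof.
move=> x0; elim: j => [|j IH]; first by rewrite mul1r.
have y0 : p ^+ j * x != 0 by rewrite mulf_neq0 ?expf_neq0.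
by rewrite exprS -mulrA theta_px // mulf_eq0 oppr_eq0 invr_eq0 (negbTE y0) IH.
Qed.

Lemma cdiff_theta z : z != 0 -> cdiff (fun x => th x) z.
Proof.
move=> z0; apply: (@cdiffM _ (fun x => qpoch x p) (fun x => qpoch (p / x) p)).
  exact: cdiff_qpoch.
apply: (@cdiff_comp _ (fun x => qpoch x p) (fun x => p / x)); last exact: cdiff_qpoch.
by apply: (@cdiffM _ (fun=> p)); [exact: cdiff_cst|exact: cdiffV].
Qed.

Lemma cont_near_neq0 (f : C -> C) z : cdiff f z -> f z != 0 ->
  \forall w \near (z : C^o), f w != 0.
Proof.
move=> /cdiff_cont/contCP h fz; have := h (normc (f z)); rewrite normc_gt0 => /(_ fz).
by apply: filterS => w; apply: contraTneq => ->; rewrite sub0r normcN ltxx.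
Qed.

(** At a zero g of theta, quasi-periodicity reduces to g = 1, where theta has the
    factor 1 - w and the cofactor does not vanish. *)
Lemma theta_isolated g : g != 0 -> \forall w \near (1 : C^o), w != 1 -> th (g * w) != 0.
Proof.
move=> g0.
have n1 : \forall w \near (1 : C^o), w != 0 by apply: near_neq0; exact: oner_neq0.
have [tg|tg] := eqVneq (th g) 0; last first.
  have d1 : cdiff (fun w => th (g * w)) 1.
    apply: (@cdiff_comp _ (fun x => th x) (fun w => g * w)).
      by apply: (@cdiffM _ (fun=> g) id); [exact: cdiff_cst|exact: cdiff_id].
    by apply: cdiff_theta; rewrite mulr1.
  have := cont_near_neq0 d1; rewrite mulr1 => /(_ tg).
  by apply: filterS => w h _.
suff main : \forall w \near (1 : C^o), w != 1 -> th w != 0.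
  apply: filterS2 n1 main => w w0 h /h; apply: contra => /eqP e; apply/eqP; move: e.
  have [j [gj|gj]] := (theta_eq0 g).1 tg => e; apply/eqP.
    have gw0 : g * w != 0 by rewrite mulf_neq0.
    by rewrite -[w]mul1r -gj mulrAC mulrC theta_pX_eq0 //; apply/eqP.
  by rewrite -(theta_pX_eq0 j.+1) // -gj; apply/eqP.
have dq : cdiff (fun w => qpoch (w * p) p * qpoch (p / w) p) 1.
  apply: (@cdiffM _ (fun w => qpoch (w * p) p) (fun w => qpoch (p / w) p)).
    apply: (@cdiff_comp _ (fun w => qpoch w p) (fun w => w * p)); last exact: cdiff_qpoch.
    by apply: (@cdiffM _ id (fun=> p)); [exact: cdiff_id|exact: cdiff_cst].
  apply: (@cdiff_comp _ (fun x => qpoch x p) (fun x => p / x)); last exact: cdiff_qpoch.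
  by apply: (@cdiffM _ (fun=> p)); [exact: cdiff_cst|apply: cdiffV; exact: oner_neq0].
have q0 : qpoch p p != 0.
  apply/eqP => /(qpoch_eq0 p1)[j]; rewrite -exprS => /(congr1 (@normc R)).
  rewrite normcX normc1 => e; have : normc p ^+ j.+1 < 1 by rewrite exprn_ilt1 ?normc_ge0.
  by rewrite e ltxx.
have := cont_near_neq0 dq; rewrite mul1r invr1 mulr1 => /(_ (mulf_neq0 q0 q0)).
apply: filterS => w h w1; rewrite /theta (qpochS p1 w) -mulrA mulf_neq0 //.
by rewrite subr_eq0 eq_sym.
Qed.

(** Moving a parameter along a real ray, rather than in all directions, keeps its
    powers away from 1. *)
Definition ray (t : R) : C := (1 + t)%:C.

Lemma ray0 : ray 0 = 1. Proof. by rewrite /ray addr0. Qed.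

Lemma ray_cont : ccont ray.
Proof.
apply: ccontP => t; last exact: cst_continuous.
apply: cvgD; [exact: cvg_cst|exact: cvg_id].
Qed.

Lemma rayX_cont m : ccont (fun t => ray t ^+ m).
Proof.
elim: m => [|m IH]; first exact: cst_ccont.
rewrite (_ : (fun t => _) = (fun t => ray t * ray t ^+ m)).
  by move=> t; apply: (@cvgM C); [exact: ray_cont|exact: IH].
by apply/funext => t; rewrite exprS.
Qed.

Lemma theta_near g m : g != 0 -> (0 < m)%N -> \forall t \near 0^'+, th (g * ray t ^+ m) != 0.
Proof.
move=> g0 m0; have /nbhsCP[d d0 hd] := theta_isolated g0.
have /contCP/(_ d d0) := @rayX_cont m 0.
rewrite ray0 expr1n => h.
near=> t; apply: hd.
  by near: t; apply: cvg_within; exact: h.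
have t0 : 0 < t by near: t; exact: nbhs_right_gt.
have r1 : 1 < (1 + t) ^+ m by rewrite exprn_egt1 ?ltrDl // -lt0n.
rewrite /ray -rmorphXn; apply/eqP => /(congr1 (@complex.Re R)) e.
by move: r1; rewrite [X in 1 < X]e ltxx.
Unshelve. all: by end_near. Qed.

End Theta.

Section ThetaSqrt.
Local Open Scope classical_set_scope.
Local Open Scope complex_scope.
Import ComplexField.Normc.
Variable R : realType.
Notation C := R[i].
Variables p sp : C.
Hypothesis p0 : p != 0.
Hypothesis p1 : normc p < 1.
Hypothesis hsp : sp ^+ 2 = p.

Lemma sp_neq0 : sp != 0.
Proof. by apply: contraNneq p0 => e; rewrite -hsp e expr0n. Qed.

Lemma sp_lt1 : normc sp < 1.
Proof.
rewrite ltNge; apply/negP => h.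
have := exprn_ege1 2 h; rewrite -normcX hsp leNgt p1 //.
Qed.

Lemma qpoch_sqr x : qpoch (x ^+ 2) p = qpoch x sp * qpoch (- x) sp.
Proof.
apply: (@clim_unique _ (qprod p (x ^+ 2))); first exact: (@qprod_clim _ _ p1).
rewrite (_ : qprod p (x ^+ 2) = (fun n => qprod sp x n * qprod sp (- x) n)).
  by apply: climM; exact: (@qprod_clim _ _ sp_lt1).
apply/funext => n; elim: n => [|n IH]; first by rewrite /qprod !big_geq // mulr1.
rewrite !qprodS IH -hsp exprAC; ring.
Qed.

Lemma theta_sqr x : x != 0 -> theta (x ^+ 2) p = theta x sp * theta (- x) sp.
Proof.
move=> x0; rewrite /theta qpoch_sqr.
have -> : p / x ^+ 2 = (sp / x) ^+ 2 by rewrite -hsp expr_div_n.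
rewrite qpoch_sqr invrN mulrN; ring.
Qed.

Lemma theta_px_sp x : x != 0 -> theta (p * x) sp = (sp * x ^+ 2)^-1 * theta x sp.
Proof.
move=> x0; have s0 := sp_neq0; rewrite -hsp expr2 -mulrA.
rewrite (theta_px s0 sp_lt1) ?mulf_neq0 // (theta_px s0 sp_lt1) //.
by field; rewrite x0 s0.
Qed.

End ThetaSqrt.

(** * Spaces of quasi-periodic functions *)

Section Quasi.
Local Open Scope classical_set_scope.
Local Open Scope complex_scope.
Import ComplexField.Normc.
Variable R : realType.
Notation C := R[i].
Variable p : C.
Hypothesis p0 : p != 0.
Hypothesis p1 : normc p < 1.
Notation th x := (theta x p).
Implicit Types f g : C -> C.

(** The A_(m-1) theta functions of norm s are those with multiplier
    c = (-1)^m / s.  Keeping c arbitrary makes the class closed under products. *)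
Definition quasi (c : C) (m : nat) f :=
  hol f /\ forall x, x != 0 -> f (p * x) = c / x ^+ m * f x.

Lemma quasiM c d m n f g : quasi c m f -> quasi d n g ->
  quasi (c * d) (m + n) (fun x => f x * g x).
Proof.
move=> [hf ef] [hg eg]; split; first exact: holM.
by move=> x x0; rewrite ef // eg // exprD; field; rewrite !expf_neq0.
Qed.

Lemma quasi_cst k : quasi 1 0 (fun=> k).
Proof. by split=> [z _|x _]; [exact: cdiff_cst|rewrite expr0 divr1 mul1r]. Qed.

Lemma quasiZ k c m f : quasi c m f -> quasi c m (fun x => k * f x).
Proof. by move=> /(quasiM (quasi_cst k)); rewrite mul1r. Qed.

Lemma quasi_prod (I : finType) (P : pred I) (c : I -> C) (f : I -> C -> C) :
  (forall i, P i -> quasi (c i) 1 (f i)) ->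
  quasi (\prod_(i | P i) c i) #|P| (fun x => \prod_(i | P i) f i x).
Proof.
move=> qf; split=> [z z0|x x0]; first by apply: cdiff_prod => i /qf[h _]; exact: h.
rewrite (eq_bigr (fun i => (c i / x) * f i x)) => [|i /qf[_ h]]; last exact: h.
by rewrite !big_split /= prodfV prodr_const.
Qed.

Lemma quasi_theta (g : C) : g != 0 -> quasi (- g^-1) 1 (fun x => th (g * x)).
Proof.
move=> g0; split=> [z z0|x x0].
  apply: (@cdiff_comp _ (fun x => th x) (fun x => g * x)).
    by apply: (@cdiffM _ (fun=> g) id); [exact: cdiff_cst|exact: cdiff_id].
  by apply: (cdiff_theta p1); rewrite mulf_neq0.
by rewrite mulrCA (theta_px p0 p1) ?mulf_neq0 // expr1 invfM !mulNr.
Qed.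

Lemma quasi_ell c m f k : quasi c m f -> p ^ k * ell k f = c * ell (k + m%:Z) f.
Proof.
move=> [hf ef]; rewrite -(ell_scale k hf p0).
rewrite (@eq_ell _ k _ (fun x => c * (x ^ (- m%:Z) * f x))).
  by rewrite ellZ ?ell_shift ?opprK //; exact: hol_expfM.
by move=> x x0; rewrite ef // -exprnN mulrA.
Qed.

(** By [quasi_ell] the k-th and (k+m)-th Laurent coefficients vanish together. *)
Lemma quasi_inj c m f (k0 : int) : c != 0 -> (0 < m)%N -> quasi c m f ->
  (forall j : nat, (j < m)%N -> ell (k0 + j%:Z) f = 0) ->
  forall x, x != 0 -> f x = 0.
Proof.
move=> c0 m0 qf h0; have [hf _] := qf.
have up k : ell k f = 0 -> ell (k + m%:Z) f = 0.
  move=> e; have := quasi_ell k qf; rewrite e mulr0 => /esym/eqP.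
  by rewrite mulf_eq0 (negbTE c0) => /eqP.
have dn k : ell (k + m%:Z) f = 0 -> ell k f = 0.
  move=> e; have := quasi_ell k qf; rewrite e mulr0 => /eqP.
  by rewrite mulf_eq0 expfz_eq0 (negbTE p0) andbF => /eqP.
have all (z : int) (j : nat) : (j < m)%N -> ell (k0 + j%:Z + z * m%:Z) f = 0.
  move=> jm; elim/int_ind: z => [|z IH|z IH]; first by rewrite mul0r addr0 h0.
    by rewrite -[z.+1]addn1 PoszD mulrDl mul1r addrA; apply: up.
  apply: dn; have -> : k0 + j%:Z + - (z.+1)%:Z * m%:Z + m%:Z = k0 + j%:Z + - z%:Z * m%:Z.
    by rewrite -[z.+1]addn1 PoszD; ring.
  exact: IH.
apply: ell_unique => // k.
have mz : m%:Z != 0 by rewrite eqz_nat -lt0n.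
have e := divz_eq (k - k0) m%:Z.
have ge := modz_ge0 (k - k0) mz.
have lt : (((k - k0) %% m%:Z)%Z < m%:Z) by apply: ltz_pmod; rewrite ltz_nat.
move: e ge lt; case: ((k - k0) %% m%:Z)%Z => // j e _; rewrite ltz_nat => jm.
have -> : k = k0 + j%:Z + ((k - k0) %/ m%:Z)%Z * m%:Z.
  by rewrite -addrA [j%:Z + _]addrC -e addrC subrK.
exact: all.
Qed.

Lemma quasiD (k : C) c m f g : quasi c m f -> quasi c m g -> quasi c m (fun x => k * f x + g x).
Proof.
move=> [hf ef] [hg eg]; split; first by apply: holD; first exact: holZ.
by move=> x x0; rewrite ef // eg //; ring.
Qed.

Lemma quasi0 c m : quasi c m (fun=> 0).
Proof. by split=> [z _|x _]; [exact: cdiff_cst|rewrite mulr0]. Qed.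

Lemma ell0 k : ell k (fun=> 0 : C) = 0.
Proof.
have -> : (fun=> 0 : C) = (fun x => 0 * (fun=> 0 : C) x) :> (C -> C) by apply/funext => x; rewrite mul0r.
by rewrite ellZ ?mul0r // => z _; exact: cdiff_cst.
Qed.

Lemma ell_lin k (c : C) f g : hol f -> hol g ->
  ell k (fun x => c * f x + g x) = c * ell k f + ell k g.
Proof. by move=> hf hg; rewrite ellD ?ellZ //; exact: holZ. Qed.

Lemma dim_quasi c n : c != 0 -> @dim_le C n.+1 (quasi c n.+1).
Proof.
move=> c0; split; [exact: quasi0|by move=> k f g; exact: quasiD|].
exists (fun f (k : 'I_n.+1) => ell (k : nat)%:Z f); split.
- by move=> k f g i [hf _] [hg _]; exact: ell_lin.
- by move=> k; exact: ell0.
- move=> f qf h; apply: (@quasi_inj c n.+1 f 0) => // j jn.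
  by rewrite add0r; exact: (h (Ordinal jn)).
Qed.

Variable sp : C.
Hypothesis hsp : sp ^+ 2 = p.

(** The reflection sends the k-th Laurent coefficient to minus the (1-k)-th, so
    n of the 2n consecutive ones suffice. *)
Definition quasiC (n : nat) f := quasi (sp / p ^+ n) (2 * n) f /\
  forall x, x != 0 -> f x^-1 = - x^-1 * f x.

Lemma dim_quasiC n : @dim_le C n.+1 (quasiC n.+1).
Proof.
have s0 := sp_neq0 p0 hsp.
split.
- by split=> [|x _]; [exact: quasi0|rewrite mulr0].
- move=> k f g [qf vf] [qg vg]; split; first exact: quasiD.
  by move=> x x0; rewrite vf // vg //; ring.
exists (fun f (k : 'I_n.+1) => ell k.+1%:Z f); split.
- by move=> k f g i [[hf _] _] [[hg _] _]; exact: ell_lin.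
- by move=> k; exact: ell0.
move=> f [qf vf] h; have [hf _] := qf.
have refl k : ell (- k) f = - ell (k + 1) f.
  rewrite -ell_inv // (@eq_ell _ k _ (fun x => -1 * (x ^ (- 1) * f x))).
    by rewrite ellZ ?ell_shift ?opprK ?mulN1r //; exact: hol_expfM.
  by move=> x x0; rewrite vf // exprN1 mulN1r mulNr.
have pos (k : nat) : (k < n.+1)%N -> ell k.+1%:Z f = 0 by move=> kn; exact: (h (Ordinal kn)).
apply: (@quasi_inj _ _ f (- n%:Z) _ _ qf) => //.
  by rewrite mulf_neq0 // invr_eq0 expf_neq0.
move=> j jn; have [jn1|jn1] := ltnP j n.+1.
  have -> : - n%:Z + j%:Z = - (n - j)%N%:Z by lia.
  rewrite refl; have -> : (n - j)%N%:Z + 1 = (n - j).+1%:Z by lia.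
  by rewrite pos ?oppr0 //; lia.
have -> : - n%:Z + j%:Z = (j - n.+1).+1%:Z by lia.
by rewrite pos //; lia.
Qed.

Lemma pairs_recl n (u : 'I_n.+1 -> 'I_n.+1 -> C) :
  \prod_(i < n.+1) \prod_(j < n.+1 | (i < j)%N) u i j =
  (\prod_(j < n) u ord0 (lift ord0 j)) *
  \prod_(i < n) \prod_(j < n | (i < j)%N) u (lift ord0 i) (lift ord0 j).
Proof.
rewrite big_ord_recl big_mkcond big_ord_recl /= mul1r; congr (_ * _).
apply: eq_bigr => i _; rewrite big_mkcond big_ord_recl /= mul1r [RHS]big_mkcond.
by apply: eq_bigr => j _; rewrite /= /bump /= !add1n ltnS.
Qed.

Lemma pairs_recr n (u : 'I_n.+1 -> 'I_n.+1 -> C) :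
  \prod_(i < n.+1) \prod_(j < n.+1 | (i < j)%N) u i j =
  (\prod_(i < n) \prod_(j < n | (i < j)%N) u (widen_ord (leqnSn n) i) (widen_ord (leqnSn n) j)) *
  \prod_(i < n) u (widen_ord (leqnSn n) i) ord_max.
Proof.
rewrite big_ord_recr /= [X in _ * X]big1 ?mulr1; last first.
  by move=> j; rewrite ltnNge -ltnS ltn_ord.
rewrite -big_split; apply: eq_bigr => i _ /=.
by rewrite big_mkcond big_ord_recr /= ltn_ord -big_mkcond.
Qed.

(** By alternation it is enough to look at the first variable. *)
Lemma multi_ord0 n (S : (C -> C) -> Prop) (D : ('I_n.+1 -> C) -> C) :
  (forall k f, S f -> S (fun x => k * f x)) -> alternating D ->
  (forall x, (forall i, x i != 0) -> S (fun t => D (upd x ord0 t))) -> 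
  (forall f g, (forall x, x != 0 -> f x = g x) -> S f -> S g) -> multi S D.
Proof.
move=> SZ aD D0 Sext x i x0.
pose s := tperm ord0 i.
pose x' := fun j => x (s j).
have x'0 j : x' j != 0 by exact: x0.
apply: (Sext (fun t => (-1) ^+ s * D (upd x' ord0 t))); last by apply: SZ; exact: D0.
move=> t t0; have := aD (upd x i t) s (upd_neq0 i x0 t0).
have -> : (fun j => upd x i t (s j)) = upd x' ord0 t.
  apply/funext => j; rewrite /upd /x' (canF_eq (tpermK _ _)) tpermR.
  by [].
by move=> ->; rewrite mulrA -exprD addnn -mul2n exprM sqrrN expr1n expr1n mul1r.
Qed.

(** The Weierstrass-type product of type A: as a function of each variable it has
    multiplier (-1)^n / s. *)
Definition deltaA n (s : C) (x : 'I_n -> C) : C :=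
  th (s * \prod_i x i) *
  \prod_(i < n) \prod_(j < n | (i < j)%N) (x j * th (x i / x j)).

(** The product of type C in the sense of [quasiC]; besides the pairs, it carries
    the zeros at the powers of sp that antisymmetry forces. *)
Definition deltaC n (x : 'I_n -> C) : C :=
  (\prod_i theta (x i) sp) *
  \prod_(i < n) \prod_(j < n | (i < j)%N) ((x i)^-1 * (th (x i * x j) * th (x i / x j))).

Lemma prod_perm n (h : C -> C) (x : 'I_n -> C) (s : 'S_n) :
  \prod_i h (x (s i)) = \prod_i h (x i).
Proof. by rewrite [RHS](reindex_inj (@perm_inj _ s)). Qed.

Lemma deltaA_alt n s : alternating (@deltaA n s).
Proof.
move=> x t x0; rewrite /deltaA (prod_perm id) mulrCA; congr (_ * _).
rewrite (@alt_prod _ n (fun a b => b * th (a / b))) // => i j.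
by rewrite (theta_div p0 p1 (x0 i) (x0 j)); field.
Qed.

Lemma deltaC_alt n : alternating (@deltaC n).
Proof.
move=> x t x0; rewrite /deltaC (prod_perm (fun a => theta a sp)) mulrCA; congr (_ * _).
rewrite (@alt_prod _ n (fun a b => a^-1 * (th (a * b) * th (a / b)))) // => i j.
by rewrite (theta_div p0 p1 (x0 i) (x0 j)) (mulrC (x j) (x i)); field; rewrite x0 x0.
Qed.

Lemma quasi_ext c m f g : (forall x, x != 0 -> f x = g x) -> quasi c m f -> quasi c m g.
Proof.
move=> fg [hf ef]; split; first exact: eq_hol hf.
by move=> x x0; rewrite -!fg ?mulf_neq0 // ef.
Qed.

Lemma upd_lift n (x : 'I_n.+1 -> C) t j : upd x ord0 t (lift ord0 j) = x (lift ord0 j).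
Proof. by rewrite /upd eq_sym (negbTE (neq_lift _ _)). Qed.

Lemma deltaA_multi n s : s != 0 -> multi (quasi ((-1) ^+ n.+1 / s) n.+1) (@deltaA n.+1 s).
Proof.
move=> s0; apply: multi_ord0; [by move=> *; exact: quasiZ|exact: deltaA_alt| |by move=> f g; exact: quasi_ext].
move=> x x0.
pose K := \prod_(i < n) \prod_(j < n | (i < j)%N) (x (lift ord0 j) * th (x (lift ord0 i) / x (lift ord0 j))).
pose X := \prod_(j < n) x (lift ord0 j).
have X0 : X != 0 by apply/prodf_neq0.
have h1 := quasi_theta (mulf_neq0 s0 X0).
have h2 : quasi (\prod_(j < n) (- x (lift ord0 j))) n (fun t => \prod_(j < n) (x (lift ord0 j) * th ((x (lift ord0 j))^-1 * t))).
  rewrite -[n in quasi _ n](card_ord n); apply: quasi_prod => j _.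
  apply: quasiZ; have := @quasi_theta (x (lift ord0 j))^-1.
  by rewrite invrK invr_eq0; exact.
have := quasiZ K (quasiM h1 h2).
have -> : - (s * X)^-1 * \prod_(j < n) - x (lift ord0 j) = (-1) ^+ n.+1 / s.
  by rewrite prodrN card_ord -/X exprS; field; rewrite s0 X0.
apply: quasi_ext => t t0; rewrite /deltaA pairs_recl big_ord_recl updE.
have -> : \prod_(i < n) upd x ord0 t (lift ord0 i) = X.
  by apply: eq_bigr => i _; rewrite upd_lift.
have -> : \prod_(i < n) \prod_(j < n | (i < j)%N) (upd x ord0 t (lift ord0 j) *
   th (upd x ord0 t (lift ord0 i) / upd x ord0 t (lift ord0 j))) = K.
  by apply: eq_bigr => i _; apply: eq_bigr => j _; rewrite !upd_lift.
have -> : \prod_(j < n) (upd x ord0 t (lift ord0 j) * th (t / upd x ord0 t (lift ord0 j)))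
   = \prod_(j < n) (x (lift ord0 j) * th ((x (lift ord0 j))^-1 * t)).
  by apply: eq_bigr => j _; rewrite upd_lift (mulrC t).
have -> : s * (t * X) = s * X * t by ring.
have rg (e1 e2 e3 : C) : e3 * (e1 * e2) = e1 * (e2 * e3) by ring.
exact: rg.
Qed.

Lemma deltaC_multi n : multi (quasiC n.+1) (@deltaC n.+1).
Proof.
have s0 := sp_neq0 p0 hsp.
have sE := theta_px_sp p0 p1 hsp.
have Cext f g : (forall x, x != 0 -> f x = g x) -> quasiC n.+1 f -> quasiC n.+1 g.
  move=> fg [qf vf]; split; first exact: quasi_ext qf.
  by move=> x x0; rewrite -!fg ?invr_eq0 // vf.
apply: multi_ord0; [|exact: deltaC_alt| |exact: Cext].
  move=> k f [qf vf]; split; first exact: quasiZ.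
  by move=> x x0; rewrite vf // mulrCA.
move=> x x0.
pose A := \prod_(i < n) theta (x (lift ord0 i)) sp.
pose B := \prod_(i < n) \prod_(j < n | (i < j)%N) ((x (lift ord0 i))^-1 * (th (x (lift ord0 i) * x (lift ord0 j)) * th (x (lift ord0 i) / x (lift ord0 j)))).
pose K := A * B.
pose u a t := t^-1 * (th (a * t) * th (a^-1 * t)).
pose G t := K * (theta t sp * \prod_(j < n) u (x (lift ord0 j)) t).
apply: (Cext G).
  move=> t t0; rewrite /G /K /deltaC pairs_recl big_ord_recl updE.
  have -> : \prod_(i < n) theta (upd x ord0 t (lift ord0 i)) sp = A.
    by apply: eq_bigr => i _; rewrite upd_lift.
  have -> : \prod_(i < n) \prod_(j < n | (i < j)%N) ((upd x ord0 t (lift ord0 i))^-1 *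
     (th (upd x ord0 t (lift ord0 i) * upd x ord0 t (lift ord0 j)) *
      th (upd x ord0 t (lift ord0 i) / upd x ord0 t (lift ord0 j)))) = B.
    by apply: eq_bigr => i _; apply: eq_bigr => j _; rewrite !upd_lift.
  have -> : \prod_(j < n) (t^-1 * (th (t * upd x ord0 t (lift ord0 j)) * th (t / upd x ord0 t (lift ord0 j))))
     = \prod_(j < n) u (x (lift ord0 j)) t.
    by apply: eq_bigr => j _; rewrite upd_lift /u (mulrC t) (mulrC t).
  have rg (e1 e2 e3 e4 : C) : e3 * e4 * (e1 * e2) = e1 * e3 * (e2 * e4) by ring.
  exact: rg.
have up a t : a != 0 -> t != 0 -> u a (p * t) = (p * t ^+ 2)^-1 * u a t.
  move=> a0 t0; rewrite /u (mulrCA a p t) (mulrCA a^-1 p t).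
  rewrite !(theta_px p0 p1) ?mulf_neq0 ?invr_eq0 //; field.
  by rewrite p0 a0 t0.
have uv a t : a != 0 -> t != 0 -> u a t^-1 = u a t.
  move=> a0 t0; rewrite /u invrK.
  have -> : a * t^-1 = (a^-1 * t)^-1 by rewrite invfM invrK.
  have -> : a^-1 * t^-1 = (a * t)^-1 by rewrite invfM.
  rewrite !(thetaV p0 p1) ?mulf_neq0 ?invr_eq0 //; field.
  by rewrite a0 t0.
have hu a : a != 0 -> hol (u a).
  move=> a0; apply: holM; first by move=> z z0; exact: cdiffV.
  apply: holM; first by have [] := quasi_theta a0.
  by have [] := quasi_theta (_ : a^-1 != 0); rewrite ?invr_eq0.
split; first split.
- apply: holZ; apply: holM; first by move=> z z0; exact: (cdiff_theta (sp_lt1 p1 hsp)).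
  by move=> z z0; apply: cdiff_prod => j _; apply: hu.
- move=> t t0; rewrite /G sE //.
  rewrite (eq_bigr (fun j => (p * t ^+ 2)^-1 * u (x (lift ord0 j)) t)) => [|j _]; last exact: up.
  rewrite big_split prodr_const card_ord /= exprVn exprMn -exprM mulnS exprD [in RHS]exprS.
  set W := \prod_(i < n) _; set Z := t ^+ (2 * n); set Y := p ^+ n.
  have Z0 : Z != 0 by rewrite expf_neq0.
  have Y0 : Y != 0 by rewrite expf_neq0.
  by rewrite -hsp; field; rewrite Z0 Y0 t0 s0.
- move=> t t0; rewrite /G (thetaV s0 (sp_lt1 p1 hsp)) //.
  rewrite (eq_bigr (fun j => u (x (lift ord0 j)) t)) => [|j _]; last exact: uv.
  ring.
Qed.

End Quasi.

(** * The determinant of the functions themselves *)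

Section TypeA.
Local Open Scope classical_set_scope.
Local Open Scope complex_scope.
Import ComplexField.Normc.
Variable R : realType.
Notation C := R[i].
Variable p : C.
Hypothesis p0 : p != 0.
Hypothesis p1 : normc p < 1.
Notation th x := (theta x p).

Lemma ray_neq0 (t : R) : 0 < t -> ray t != 0.
Proof.
move=> t0; apply/eqP => /(congr1 (@complex.Re R)) /= e.
have : 0 < 1 + t by rewrite addr_gt0.
by rewrite e ltxx.
Qed.

(** With the exponents e decreasing, the ratios of the points are positive powers of
    the ray parameter, which leaves the zeros of theta at once. *)
Lemma deltaA_near n (s b : C) (e : 'I_n -> nat) : s != 0 -> b != 0 ->
  (forall i j : 'I_n, (i < j)%N -> (e j < e i)%N) ->
  (0 < \sum_i e i)%N \/ th (s * b ^+ n) != 0 ->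
  \forall t \near 0^'+, deltaA p s (fun i => b * ray t ^+ e i) != 0.
Proof.
move=> s0 b0 edec epos.
have sb0 : s * b ^+ n != 0 by rewrite mulf_neq0 // expf_neq0.
have h1 : \forall t \near 0^'+, th (s * b ^+ n * ray t ^+ (\sum_i e i)%N) != 0.
  have [epos'|] := boolP (0 < \sum_i e i)%N; first exact: theta_near.
  rewrite -eqn0Ngt => /eqP e0; case: epos => [|sbn]; first by rewrite e0.
  by apply: nearW => t; rewrite e0 mulr1.
have h2 : \forall t \near 0^'+, forall i j : 'I_n, (i < j)%N -> th (1 * ray t ^+ (e i - e j)) != 0.
  apply: filter_forall => i; apply: filter_forall => j.
  have [ij|] := boolP (i < j)%N; last by move=> _; apply: nearW.
  apply: filterS (theta_near p0 p1 (oner_neq0 _) (_ : 0 < e i - e j)%N) => //.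
  by rewrite subn_gt0 edec.
near=> t.
have t0 : 0 < t by near: t; exact: nbhs_right_gt.
have r0 := ray_neq0 t0.
rewrite /deltaA big_split prodr_const card_ord /= -expr_sum mulrA mulf_neq0 //.
  by near: t; exact: h1.
apply/prodf_neq0 => i _; apply/prodf_neq0 => j ij.
rewrite mulf_neq0 //; first by rewrite mulf_neq0 // expf_neq0.
have -> : b * ray t ^+ e i / (b * ray t ^+ e j) = 1 * ray t ^+ (e i - e j).
  rewrite -{1}(subnK (ltnW (edec _ _ ij))) exprD; field.
  by rewrite expf_neq0 // b0.
by move: i j ij; near: t; exact: h2.
Unshelve. all: by end_near. Qed.

Lemma deltaA_generic n (s b : C) (e : 'I_n -> nat) : s != 0 -> b != 0 ->
  (forall i j : 'I_n, (i < j)%N -> (e j < e i)%N) ->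
  (0 < \sum_i e i)%N \/ th (s * b ^+ n) != 0 ->
  exists r : C, r != 0 /\ deltaA p s (fun i => b * r ^+ e i) != 0.
Proof.
move=> s0 b0 edec epos.
have h := deltaA_near s0 b0 edec epos.
have h' : \forall t \near 0^'+, 0 < t /\ deltaA p s (fun i => b * ray t ^+ e i) != 0.
  by apply: filterS2 (nbhs_right_gt 0) h.
have [t [t0 ht]] := filter_ex h'.
by exists (ray t); split=> //; exact: ray_neq0.
Qed.

Lemma card_ord_gt n (j : 'I_n) : #|[pred k : 'I_n | (j < k)%N]| = (n - j.+1)%N.
Proof.
rewrite -sum1_card -(big_mkord (fun k => (j < k)%N) (fun=> 1%N)).
rewrite -(@big_nat_widenl _ _ _ j.+1 0 n xpredT (fun=> 1%N)) //.
by rewrite sum_nat_const_nat muln1.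
Qed.

Lemma quasi_entry n (sigma : C) (a : 'I_n -> C) (P : C -> C) (j : 'I_n) :
  sigma != 0 -> (forall i, a i != 0) ->
  quasi p ((-1) ^+ j.+1 / (sigma * \prod_(k < n | (k <= j)%N) a k)) j.+1 P ->
  quasi p ((-1) ^+ n / (sigma * \prod_k a k)) n
    (fun x => P x * \prod_(k < n | (j < k)%N) th (a k * x)).
Proof.
move=> s0 a0 qP.
have := @quasi_prod R p _ [pred k : 'I_n | (j < k)%N] (fun k => - (a k)^-1)
  (fun k x => th (a k * x)) (fun k _ => quasi_theta p0 p1 (a0 k)).
rewrite card_ord_gt => /(quasiM qP); rewrite subnKC //.
have -> : (-1) ^+ j.+1 / (sigma * \prod_(k < n | (k <= j)%N) a k) *
   \prod_(i < n | [pred k : 'I_n | (j < k)%N] i) - (a i)^-1 = (-1) ^+ n / (sigma * \prod_k a k).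
  rewrite prodrN card_ord_gt prodfV (bigID (fun k : 'I_n => (k <= j)%N) predT) /=.
  have -> : \prod_(i < n | ~~ (i <= j)%N) a i = \prod_(i < n | (j < i)%N) a i.
    by apply: eq_bigl => k; rewrite ltnNge.
  have -> : (-1) ^+ n = (-1) ^+ j.+1 * (-1) ^+ (n - j.+1) :> C by rewrite -exprD subnKC.
  field; rewrite s0 !andbT; apply/andP; split; exact/prodf_neq0.
by [].
Qed.

Lemma det_row_scale n (A : 'M[C]_n) (r : 'I_n -> C) :
  \det (\matrix_(i, j) (A i j * r i)) = \det A * \prod_i r i.
Proof.
have -> : \matrix_(i, j) (A i j * r i) = diag_mx (\row_i r i) *m A.
  by apply/matrixP => i j; rewrite mul_diag_mx !mxE mulrC.
rewrite det_mulmx det_diag mulrC; congr (_ * _).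
by apply: eq_bigr => i _; rewrite mxE.
Qed.

(** By [alternant_det] the determinant can be computed at any point where deltaA
    does not vanish.  With the last coordinate equal to 1 / a_n, only the last
    entry of the last row survives, and the cofactor is the same determinant for
    n - 1; deltaA degenerates in the same way. *)
Theorem typeA_eval n (sigma : C) (a : 'I_n -> C) (P : 'I_n -> C -> C) (x : 'I_n -> C) :
  sigma != 0 -> th sigma != 0 -> (forall i, a i != 0) -> (forall i, x i != 0) ->
  (forall j : 'I_n,
    quasi p ((-1) ^+ j.+1 / (sigma * \prod_(k < n | (k <= j)%N) a k)) j.+1 (P j)) ->
  \det (\matrix_(i < n, j < n) (P j (x i) * \prod_(k < n | (j < k)%N) th (a k * x i))) * th sigma =
  deltaA p (sigma * \prod_k a k) x * \prod_j (P j (a j)^-1 * a j ^+ j).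
Proof.
move=> s0 ts; elim: n a P x => [|n IH] a P x a0 x0 qP.
  by rewrite det_mx00 /deltaA !big_ord0 !mulr1 mul1r.
pose W := widen_ord (leqnSn n).
pose G (j : 'I_n.+1) t := P j t * \prod_(k < n.+1 | (j < k)%N) th (a k * t).
set s := sigma * \prod_k a k.
have sn0 : s != 0 by rewrite mulf_neq0 //; apply/prodf_neq0.
have c0 : (-1) ^+ n.+1 / s != 0 by rewrite mulf_neq0 ?invr_eq0 // expf_neq0 // oppr_eq0 oner_neq0.
have QG j : quasi p ((-1) ^+ n.+1 / s) n.+1 (G j) by exact: quasi_entry.
have sE : s = sigma * \prod_(k < n) a (W k) * a ord_max by rewrite /s big_ord_recr /= mulrA.
set b := (a ord_max)^-1.
have b0 : b != 0 by rewrite invr_eq0.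
(* nodes ending at 1 / a_n; for n = 0 there is no ray to follow, and
   nonvanishing is the assumption on sigma *)
have [r [r0 yD]] : exists r : C, r != 0 /\ deltaA p s (fun i : 'I_n.+1 => b * r ^+ (n - i)) != 0.
  apply: deltaA_generic => // [i j ij|].
    by have := ltn_ord j; lia.
  have [n0|n0] := posnP n; last by left; rewrite big_ord_recl /= subn0 ltn_addr.
  right; have -> : b ^+ n.+1 = b by rewrite n0.
  rewrite sE big1 ?mulr1 => [|k _]; first by rewrite mulfK.
  by exfalso; move: (leq_ltn_trans (leq0n k) (ltn_ord k)); lia.
pose y (i : 'I_n.+1) := b * r ^+ (n - i).
have y0 i : y i != 0 by rewrite mulf_neq0 // expf_neq0.
have yM : y ord_max = b by rewrite /y subnn mulr1.
have AL := alternant_det (dim_quasi p0 n c0) (deltaA_multi p0 p1 sn0) (@deltaA_alt _ _ p0 p1 _ _) QG x0 y0.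
pose y' i := y (W i).
have IHy := IH (fun i => a (W i)) (fun j => P (W j)) y' (fun i => a0 _) (fun i => y0 _).
have detY : \det (\matrix_(i, j) G j (y i)) = P ord_max b * \prod_(i < n) th (a ord_max * y' i) *
   \det (\matrix_(i < n, j < n) (P (W j) (y' i) * \prod_(k < n | (j < k)%N) th (a (W k) * y' i))).
  rewrite (expand_det_row _ ord_max) (bigD1 ord_max) //= big1 ?addr0 => [|j jM]; last first.
    rewrite mxE /G yM (bigD1 ord_max) /=; last by rewrite ltn_neqAle -ltnS ltn_ord andbT.
    by rewrite mulfV // (theta1 p1) !(mul0r, mulr0).
  rewrite mxE /G yM big1 ?mulr1; last by move=> k; rewrite ltnNge -ltnS ltn_ord.
  rewrite /cofactor /= addnn -mul2n exprM sqrrN !expr1n mul1r -mulrA; congr (_ * _).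
  rewrite mulrC -det_row_scale; congr (\det _); apply/matrixP => i j; rewrite !mxE.
  have lW k : lift ord_max k = W k by apply: val_inj; rewrite /= /bump leqNgt ltn_ord.
  rewrite !lW /G -mulrA; congr (_ * _).
  by rewrite big_mkcond big_ord_recr /= ltn_ord -big_mkcond.
have dY : deltaA p s y = deltaA p (sigma * \prod_(k < n) a (W k)) y' *
    (b ^+ n * \prod_(i < n) th (a ord_max * y' i)).
  have e1 : s * (\prod_(i < n) y (W i) * b) = sigma * \prod_(k < n) a (W k) * \prod_i y' i.
    by rewrite sE /b; field; exact: a0.
  have e2 : \prod_(i < n) (b * th (y (W i) / b)) = b ^+ n * \prod_(i < n) th (a ord_max * y' i).
    rewrite big_split prodr_const card_ord; congr (_ * _); apply: eq_bigr => i _.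
    by rewrite /b invrK mulrC.
  by rewrite /deltaA pairs_recr big_ord_recr /= yM -/W e1 e2 !mulrA.
have qW (j : 'I_n) : quasi p ((-1) ^+ j.+1 / (sigma * \prod_(k < n | (k <= j)%N) a (W k))) j.+1 (P (W j)).
  have := qP (W j); rewrite big_mkcond big_ord_recr /= leqNgt ltn_ord /= mulr1.
  by rewrite -big_mkcond.
have {}IHy := IHy qW.
have ab : a ord_max ^+ n * b ^+ n = 1 by rewrite -exprMn divff ?expr1n.
have alg (E Dx d1 t Pb H D' Pi an bn : C) : D' * (bn * H) != 0 -> an * bn = 1 ->
    E * (D' * (bn * H)) = Dx * (Pb * H * d1) -> d1 * t = D' * Pi ->
    E * t = Dx * (Pi * (Pb * an)).
  move=> h0 h1 h2 h3; apply: (mulIf h0); rewrite mulrAC h2.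
  have -> : Dx * (Pb * H * d1) * t = Dx * Pb * H * (d1 * t) by ring.
  have -> : Dx * (Pi * (Pb * an)) * (D' * (bn * H)) = Dx * Pb * H * (D' * Pi) * (an * bn) by ring.
  by rewrite h3 h1 mulr1.
rewrite big_ord_recr /=; apply: (alg _ _ _ _ _ (\prod_(i < n) th (a ord_max * y' i)) _ _ _ _ _ ab _ IHy).
  by rewrite -dY.
by rewrite -dY -detY.
Qed.

End TypeA.

(** * The determinant of the antisymmetrized functions, for generic c *)

Section TypeC.
Local Open Scope classical_set_scope.
Local Open Scope complex_scope.
Import ComplexField.Normc.
Variable R : realType.
Notation C := R[i].
Variables p sp : C.
Hypothesis p0 : p != 0.
Hypothesis p1 : normc p < 1.
Hypothesis hsp : sp ^+ 2 = p.
Notation th x := (theta x p).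

Let s0 : sp != 0. Proof. exact: sp_neq0 p0 hsp. Qed.

Definition thprod n (c : 'I_n -> C) (x : C) : C := \prod_k th (c k * x).

(** The operator T of the introduction, antisymmetric by construction:
    T g (1/x) = - T g (x) / x. *)
Definition antisym n (c : 'I_n -> C) (g : C -> C) (x : C) : C :=
  x ^- n * thprod c x * g x - x ^+ n.+1 * thprod c x^-1 * g x^-1.

(** The norm of the theta functions to which [antisym] is applied. *)
Definition norm_of n (c : 'I_n -> C) : C := (sp * \prod_k c k)^-1.

Lemma norm_of_neq0 n (c : 'I_n -> C) : (forall k, c k != 0) -> norm_of c != 0.
Proof. by move=> c0; rewrite invr_eq0 mulf_neq0 //; apply/prodf_neq0. Qed.

Lemma quasiC_antisym n (c : 'I_n -> C) g : (forall k, c k != 0) ->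
  quasi p ((-1) ^+ n / norm_of c) n g -> quasiC p sp n (antisym c g).
Proof.
move=> c0 qg; set F := fun x => thprod c x * g x.
have qF : quasi p sp (2 * n) F.
  have := @quasi_prod R p _ predT (fun k => - (c k)^-1) (fun k x => th (c k * x))
    (fun k _ => quasi_theta p0 p1 (c0 k)).
  rewrite card_ord => /quasiM/(_ qg); rewrite -/F addnn -mul2n.
  have -> : \prod_k - (c k)^-1 * ((-1) ^+ n / norm_of c) = sp.
    rewrite prodrN card_ord prodfV /norm_of invrK mulrACA -exprMn mulrNN mulr1 expr1n mul1r.
    by rewrite mulrCA mulVf ?mulr1 //; apply/prodf_neq0.
  by [].
have [hF eF] := qF.
have GE x : antisym c g x = x ^- n * F x - x ^+ n.+1 * F x^-1.
  by rewrite /antisym /F !mulrA.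
have hFV : hol (fun x => F x^-1).
  by move=> z z0; apply: (@cdiff_comp _ F (fun x => x^-1)); [exact: cdiffV|apply: hF; rewrite invr_eq0].
have hX m : hol (fun x : C => x ^+ m) by move=> z z0; apply: (@cdiffX _ id); exact: cdiff_id.
have hXV m : hol (fun x : C => x ^- m).
  move=> z z0; apply: (@cdiff_comp _ (fun x => x^-1) (fun x => x ^+ m)); first exact: hX.
  by apply: cdiffV; rewrite expf_neq0.
split; first split.
- apply: (@eq_hol _ (fun x => x ^- n * F x + -1 * (x ^+ n.+1 * F x^-1))).
    by move=> z _; rewrite GE mulN1r.
  by apply: holD; [apply: holM|apply: holZ; apply: holM].
- move=> x x0; rewrite !GE eF //.
  have px0 : p * x != 0 by rewrite mulf_neq0.
  have eV : F (p * x)^-1 = F x^-1 / (sp * (p * x) ^+ (2 * n)).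
    have := eF (p * x)^-1; rewrite invr_eq0 => /(_ px0).
    have -> : p * (p * x)^-1 = x^-1 by field; rewrite x0.
    move=> ->; rewrite exprVn invrK; field.
    by rewrite expf_neq0 // s0.
  rewrite eV (mulnC 2 n) !exprM [x ^+ n.+1]exprS [_ ^+ n.+1]exprS !exprMn.
  set X := x ^+ n; set Y := p ^+ n.
  have X0 : X != 0 by rewrite expf_neq0.
  have Y0 : Y != 0 by rewrite expf_neq0.
  move: (F x) (F x^-1) X Y X0 Y0 => A B X Y X0 Y0.
  by rewrite -hsp; field; rewrite ?X0 ?Y0 ?s0 ?x0.
- move=> x x0; rewrite !GE !exprVn !invrK !exprS.
  have X0 : x ^+ n != 0 by rewrite expf_neq0.
  by field; rewrite X0 x0.
Qed.

Lemma prod_split3 n (w : 'I_n -> 'I_n -> C) :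
  \prod_i \prod_k w i k = (\prod_(i < n) \prod_(k < n | (i < k)%N) w i k) * (\prod_i w i i) *
    (\prod_(i < n) \prod_(k < n | (i < k)%N) w k i).
Proof.
rewrite [X in _ = _ * X](exchange_big_dep xpredT) //= -!big_split; apply: eq_bigr => i _ /=.
rewrite (bigID (fun k : 'I_n => (i < k)%N)) /= -mulrA; congr (_ * _).
rewrite (bigD1 i) /= ?ltnn //; congr (_ * _); apply: eq_bigl => k.
by rewrite -leqNgt andbC ltn_neqAle.
Qed.

Lemma thprod_root n (c : 'I_n -> C) i : c i != 0 -> thprod c (c i)^-1 = 0.
Proof. by move=> ci; rewrite /thprod (bigD1 i) //= divff // (theta1 p1) mul0r. Qed.

(** The value of det (T e_k (x_i)) / deltaC x, up to a power of deltaA, for the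
    Lagrange functions e_k. *)
Definition constC n (c : 'I_n -> C) : C :=
  th sp^-1 / (\prod_i c i) * (\prod_i theta (- c i) sp) *
  \prod_(i < n) \prod_(j < n | (i < j)%N) th (c i * c j).

(** The product of h (c_i) contains theta (c_i c_j) twice for i < j and once on
    the diagonal, where theta (c^2; p) = theta (c; sp) theta (-c; sp). *)
Lemma deltaA_deltaC_at_c n (c : 'I_n -> C) : (forall k, c k != 0) ->
  (\prod_i (c i ^- n * thprod c (c i))) * deltaA p (norm_of c) c = deltaC p sp c * constC c.
Proof.
move=> c0; rewrite big_split /= /thprod.
pose A := \prod_(i < n) \prod_(k < n | (i < k)%N) c i.
pose B := \prod_(i < n) \prod_(k < n | (i < k)%N) c k.
pose P := \prod_i c i.
pose S := \prod_(i < n) \prod_(k < n | (i < k)%N) th (c i * c k).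
pose T := \prod_(i < n) \prod_(k < n | (i < k)%N) th (c i / c k).
pose U := \prod_i theta (c i) sp.
pose V := \prod_i theta (- c i) sp.
have A0 : A != 0 by apply/prodf_neq0 => i _; apply/prodf_neq0.
have B0 : B != 0 by apply/prodf_neq0 => i _; apply/prodf_neq0.
have P0 : P != 0 by apply/prodf_neq0.
have e1 : \prod_i c i ^- n = (A * P * B)^-1.
  rewrite /A /P /B -(prod_split3 (fun i _ => c i)) -prodfV; apply: eq_bigr => i _.
  by rewrite prodr_const card_ord.
have e2 : \prod_i \prod_k th (c k * c i) = S * (U * V) * S.
  have -> : U * V = \prod_i (theta (c i) sp * theta (- c i) sp) by rewrite big_split.
  rewrite (prod_split3 (fun i k => th (c k * c i))); congr (_ * _ * _).
    by apply: eq_bigr => i _; apply: eq_bigr => k _; rewrite mulrC.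
  by apply: eq_bigr => i _; rewrite -expr2 (theta_sqr p1 hsp).
have e3 : deltaA p (norm_of c) c = th sp^-1 * (B * T).
  rewrite /deltaA /norm_of -/P; congr (th _ * _).
    by field; rewrite P0 s0.
  rewrite -big_split; apply: eq_bigr => i _; by rewrite -big_split.
have e4 : deltaC p sp c = U * (A^-1 * (S * T)).
  rewrite /deltaC -/U; congr (_ * _).
  rewrite -prodfV -!big_split; apply: eq_bigr => i _ /=.
  by rewrite -prodfV -!big_split.
rewrite e1 e2 e3 e4 /constC -/P -/V -/S; field.
by rewrite A0 B0 P0.
Qed.

(** Not normalized: at its own node the value is [deltaA]. *)
Definition lagrange n (s : C) (z : 'I_n -> C) (k : 'I_n) (t : C) : C := deltaA p s (upd z k t).

Lemma lagrange_offdiag n (s : C) (z : 'I_n -> C) i k : (forall j, z j != 0) -> i != k ->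
  lagrange s z k (z i) = 0.
Proof.
move=> z0 ik; apply: (alternating_eq0 (deltaA_alt p0 p1 s) (upd_neq0 k z0 (z0 i)) ik).
by rewrite updE /upd (negbTE ik).
Qed.

Lemma lagrange_diag n (s : C) (z : 'I_n -> C) k : lagrange s z k (z k) = deltaA p s z.
Proof. by rewrite /lagrange upd_id. Qed.

Lemma det_lagrange n (s : C) (z : 'I_n -> C) : (forall j, z j != 0) ->
  \det (\matrix_(i, k) lagrange s z k (z i)) = deltaA p s z ^+ n.
Proof.
move=> z0; rewrite (_ : \matrix_(i, k) _ = (deltaA p s z)%:M) ?det_scalar //.
apply/matrixP => i k; rewrite !mxE; case: eqVneq => [->|ik]; first by rewrite lagrange_diag.
by rewrite lagrange_offdiag.
Qed.

(** At x = c the second term of each entry vanishes, by [thprod_root]; what is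
    left is the determinant of the Lagrange functions themselves, which is
    evaluated at their nodes. *)
Lemma det_antisym_generic n (c x z : 'I_n.+1 -> C) :
  (forall k, c k != 0) -> (forall k, x k != 0) -> (forall k, z k != 0) ->
  deltaC p sp c != 0 ->
  \det (\matrix_(i, k) antisym c (lagrange (norm_of c) z k) (x i)) * deltaA p (norm_of c) z =
  deltaC p sp x * constC c * deltaA p (norm_of c) z ^+ n.+1.
Proof.
move=> c0 x0 z0 dc.
set s := norm_of c; have sn0 : s != 0 by exact: norm_of_neq0.
have mult0 : (-1) ^+ n.+1 / s != 0 by apply: mulf_neq0; [rewrite expf_neq0 // oppr_eq0 oner_neq0|rewrite invr_eq0].
have qe k : quasi p ((-1) ^+ n.+1 / s) n.+1 (lagrange s z k) by exact: (deltaA_multi p0 p1 sn0).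
have qTe k : quasiC p sp n.+1 (antisym c (lagrange s z k)) by exact: quasiC_antisym.
have AC := alternant_det (dim_quasiC p0 p1 hsp n) (deltaC_multi p0 p1 hsp (n := n))
  (deltaC_alt p0 p1 sp (n := n.+1)) qTe x0 c0.
have AA := alternant_det (dim_quasi p0 n mult0) (deltaA_multi p0 p1 sn0)
  (deltaA_alt p0 p1 s (n := n.+1)) qe c0 z0.
have eC : \det (\matrix_(i, k) antisym c (lagrange s z k) (c i)) =
    \det (\matrix_(i, k) lagrange s z k (c i)) * \prod_i (c i ^- n.+1 * thprod c (c i)).
  rewrite -det_row_scale; congr (\det _); apply/matrixP => i k; rewrite !mxE.
  by rewrite /antisym thprod_root // mulr0 mul0r subr0 mulrC.
have alg (D Dc E dC dX r dA dAc q m m' : C) : dC != 0 -> D * dC = dX * Dc -> Dc = E * r ->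
    E * dA = dAc * m -> m = m' -> r * dAc = dC * q -> D * dA = dX * q * m'.
  move=> h0 h1 hc h2 <- h3; apply: (mulIf h0); rewrite mulrAC h1 hc.
  have -> : dX * (E * r) * dA = dX * r * (E * dA) by ring.
  rewrite h2; have -> : dX * r * (dAc * m) = dX * (r * dAc) * m by ring.
  by rewrite h3; ring.
exact: (alg _ _ _ _ _ _ _ _ _ _ _ dc AC eC AA (det_lagrange s z0) (deltaA_deltaC_at_c c0)).
Qed.

End TypeC.

(** * Passage to arbitrary c *)

Section Continuity.
Local Open Scope classical_set_scope.
Local Open Scope complex_scope.
Import ComplexField.Normc.
Variable R : realType.
Notation C := R[i].

Definition cont0 (F : R -> C) := {for 0, continuous (F : R -> C^o)}.

Lemma cont0_cst k : cont0 (fun=> k).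
Proof. exact: cst_ccont. Qed.

Lemma cont0M F G : cont0 F -> cont0 G -> cont0 (fun t => F t * G t).
Proof. by move=> cF cG; apply: (@cvgM C); [exact: cF|exact: cG]. Qed.

Lemma cont0D F G : cont0 F -> cont0 G -> cont0 (fun t => F t + G t).
Proof. by move=> cF cG; apply: (@cvgD _ C^o); [exact: cF|exact: cG]. Qed.

Lemma cont0_comp (f : C -> C) F : cont0 F -> cdiff f (F 0) -> cont0 (fun t => f (F t)).
Proof.
move=> cF /cdiff_cont cf.
exact: (@continuous_comp R C^o C^o F f 0 cF cf).
Qed.

Lemma cont0_prod (I : finType) (P : pred I) (F : I -> R -> C) :
  (forall i, P i -> cont0 (F i)) -> cont0 (fun t => \prod_(i | P i) F i t).
Proof.
move=> cF; rewrite (_ : (fun t => _) = \big[(fun f g t => f t * g t)/(fun=> 1)]_(i | P i) F i).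
  apply: (@big_ind _ (fun f : R -> C => cont0 f)); [exact: cont0_cst|exact: cont0M|exact: cF].
apply/funext => w; apply: (big_ind2 (fun x (f : R -> C) => x = f w)) => //.
by move=> x f y g -> ->.
Qed.

Lemma cont0_sum (I : finType) (F : I -> R -> C) :
  (forall i, cont0 (F i)) -> cont0 (fun t => \sum_i F i t).
Proof.
move=> cF; rewrite (_ : (fun t => _) = \big[(fun f g t => f t + g t)/(fun=> 0)]_i F i).
  apply: (@big_ind _ (fun f : R -> C => cont0 f)); [exact: cont0_cst|exact: cont0D|by move=> i _; exact: cF].
apply/funext => w; apply: (big_ind2 (fun x (f : R -> C) => x = f w)) => //.
by move=> x f y g -> ->.
Qed.

Lemma cont0X F n : cont0 F -> cont0 (fun t => F t ^+ n).
Proof.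
move=> cF; rewrite (_ : (fun t => _) = (fun t => \prod_(i < n) F t)).
  by apply: cont0_prod => i _; exact: cF.
by apply/funext => t; rewrite prodr_const card_ord.
Qed.

Lemma cont0_det n (F : 'I_n -> 'I_n -> R -> C) : (forall i j, cont0 (F i j)) ->
  cont0 (fun t => \det (\matrix_(i, j) F i j t)).
Proof.
move=> cF; rewrite (_ : (fun t => _) = (fun t => \sum_(s : 'S_n) ((-1) ^+ s * \prod_i F i (s i) t))).
  by apply: cont0_sum => s; apply: cont0M; [exact: cont0_cst|apply: cont0_prod => i _; exact: cF].
apply/funext => t; apply: eq_bigr => s _; congr (_ * _).
by apply: eq_bigr => i _; rewrite mxE.
Qed.

Lemma cont0_eq F G : cont0 F -> cont0 G -> (\forall t \near 0^'+, F t = G t) -> F 0 = G 0.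
Proof.
move=> cF cG FG.
pose H t := F t + -1 * G t.
have cH : cont0 H by apply: cont0D; [exact: cF|apply: cont0M; [exact: cont0_cst|exact: cG]].
apply/eqP; rewrite -subr_eq0 -mulN1r -normc_eq0 eq_le normc_ge0 andbT.
apply/ler_addgt0Pl => e e0; rewrite addr0.
have /contCP/(_ e e0) h := cH.
have h' : \forall t \near 0^'+, normc (H t - H 0) < e by apply: cvg_within; exact: h.
have hFG : \forall t \near (0 : R)^'+, normc (H t - H 0) < e /\ F t = G t.
  by apply: filterS2 h' FG => t h1 h2; split.
have [t ht'] := @filter_ex _ _ (at_right_proper_filter (0 : R)) _ hFG.
case: ht' => ht et.
have e1 : H t = 0 by rewrite /H et mulN1r subrr.
by move: ht; rewrite e1 sub0r normcN => /ltW.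
Qed.

End Continuity.

Section Final.
Local Open Scope classical_set_scope.
Local Open Scope complex_scope.
Import ComplexField.Normc.
Variable R : realType.
Notation C := R[i].
Variables p sp : C.
Hypothesis p0 : p != 0.
Hypothesis p1 : normc p < 1.
Hypothesis hsp : sp ^+ 2 = p.
Notation th x := (theta x p).

Let s0 : sp != 0. Proof. exact: sp_neq0 p0 hsp. Qed.
Let s1 : normc sp < 1. Proof. exact: sp_lt1 p1 hsp. Qed.

Lemma cont0_theta (q : C) (F : R -> C) : normc q < 1 -> cont0 F -> F 0 != 0 ->
  cont0 (fun t => theta (F t) q).
Proof.
move=> q1 cF F0; apply: (@cont0_comp _ (fun x => theta x q) F cF).
exact: cdiff_theta.
Qed.

Lemma cont0V (F : R -> C) : cont0 F -> F 0 != 0 -> cont0 (fun t => (F t)^-1).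
Proof. by move=> cF F0; apply: (@cont0_comp _ (fun x => x^-1) F cF); exact: cdiffV. Qed.

Lemma cont0_deltaA n (s : R -> C) (z : 'I_n -> C) : cont0 s -> s 0 != 0 ->
  (forall i, z i != 0) -> cont0 (fun t => deltaA p (s t) z).
Proof.
move=> cs s00 z0; apply: cont0M; last exact: cont0_cst.
apply: (cont0_theta p1); first by apply: cont0M; [exact: cs|exact: cont0_cst].
by rewrite mulf_neq0 //; apply/prodf_neq0.
Qed.

Section Perturb.
Variables (n : nat) (c : 'I_n -> C).
Hypothesis c0 : forall k, c k != 0.

(** The exponents are distinct and positive, so that every c_i c_j, c_i / c_j
    with i < j, and c_i moves along a ray: this leaves the zeros of deltaC at
    once. *)
Definition perturb (t : R) (k : 'I_n) : C := c k * ray t ^+ (n - k).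

Lemma perturb0 : perturb 0 = c.
Proof. by apply/funext => k; rewrite /perturb ray0 expr1n mulr1. Qed.

Lemma perturb00 k : perturb 0 k != 0.
Proof. by rewrite perturb0. Qed.

Lemma cont0_perturb k : cont0 (perturb^~ k).
Proof. by apply: cont0M; [exact: cont0_cst|exact: rayX_cont]. Qed.

Lemma cont0_norm : cont0 (fun t => norm_of sp (perturb t)).
Proof.
apply: cont0V.
  by apply: cont0M; [exact: cont0_cst|apply: cont0_prod => k _; exact: cont0_perturb].
by rewrite mulf_neq0 //; apply/prodf_neq0 => k _; exact: perturb00.
Qed.

Lemma cont0_thprod x : x != 0 -> cont0 (fun t => thprod p (perturb t) x).
Proof.
move=> x0; apply: cont0_prod => k _; apply: (cont0_theta p1).
  by apply: cont0M; [exact: cont0_perturb|exact: cont0_cst].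
by rewrite mulf_neq0 ?perturb00.
Qed.

Lemma cont0_antisym m (z : 'I_m -> C) k x : (forall i, z i != 0) -> x != 0 ->
  cont0 (fun t => antisym p (perturb t) (lagrange p (norm_of sp (perturb t)) z k) x).
Proof.
move=> z0 x0.
have norm00 : norm_of sp (perturb 0) != 0 by apply: (norm_of_neq0 p0 hsp); exact: perturb00.
have cl y : y != 0 -> cont0 (fun t => lagrange p (norm_of sp (perturb t)) z k y).
  by move=> y0; apply: (cont0_deltaA cont0_norm norm00); exact: upd_neq0.
have xV : x^-1 != 0 by rewrite invr_eq0.
rewrite (_ : (fun t => _) = (fun t => x ^- n * thprod p (perturb t) x *
    lagrange p (norm_of sp (perturb t)) z k x + -1 * (x ^+ n.+1 * thprod p (perturb t) x^-1 *
    lagrange p (norm_of sp (perturb t)) z k x^-1))); last first.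
  by apply/funext => t; rewrite mulN1r.
apply: cont0D; [|apply: cont0M; first exact: cont0_cst].
  apply: cont0M; last exact: cl.
  by apply: cont0M; [exact: cont0_cst|exact: cont0_thprod].
apply: cont0M; last exact: cl.
by apply: cont0M; [exact: cont0_cst|exact: cont0_thprod].
Qed.

Lemma cont0_constC : cont0 (fun t => constC p sp (perturb t)).
Proof.
apply: cont0M; first apply: cont0M; first apply: cont0M.
- exact: cont0_cst.
- apply: cont0V; first by apply: cont0_prod => k _; exact: cont0_perturb.
  by apply/prodf_neq0 => k _; exact: perturb00.
- apply: cont0_prod => k _; apply: (cont0_theta s1); last by rewrite oppr_eq0 perturb00.
  rewrite (_ : (fun t => _) = (fun t => -1 * perturb t k)).
    by apply: cont0M; [exact: cont0_cst|exact: cont0_perturb].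
  by apply/funext => t; rewrite mulN1r.
- apply: cont0_prod => i _; apply: cont0_prod => j _; apply: (cont0_theta p1).
    by apply: cont0M; exact: cont0_perturb.
  by rewrite mulf_neq0 ?perturb00.
Qed.

Lemma deltaC_near : \forall t \near 0^'+,
  (forall k, perturb t k != 0) /\ deltaC p sp (perturb t) != 0.
Proof.
have epos (k : 'I_n) : (0 < n - k)%N by rewrite subn_gt0.
have h1 : \forall t \near 0^'+, forall i, theta (c i * ray t ^+ (n - i)) sp != 0.
  by apply: filter_forall => i; apply: theta_near.
have h2 : \forall t \near 0^'+, forall i j, th (c i * c j * ray t ^+ ((n - i) + (n - j))) != 0.
  apply: filter_forall => i; apply: filter_forall => j; apply: theta_near => //.
    by rewrite mulf_neq0.
  by rewrite addn_gt0 epos.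
have h3 : \forall t \near 0^'+, forall i j : 'I_n, (i < j)%N -> th (c i / c j * ray t ^+ ((n - i) - (n - j))) != 0.
  apply: filter_forall => i; apply: filter_forall => j.
  have [ij|] := boolP (i < j)%N; last by move=> _; apply: nearW.
  apply: filterS (theta_near p0 p1 (_ : c i / c j != 0) (_ : 0 < (n - i) - (n - j))%N) => //.
    by rewrite mulf_neq0 ?invr_eq0.
  by have := ltn_ord j; lia.
near=> t.
have t0 : 0 < t by near: t; exact: nbhs_right_gt.
have r0 := ray_neq0 t0.
have cp k : perturb t k != 0 by rewrite mulf_neq0 // expf_neq0.
split=> //; apply: mulf_neq0.
  by apply/prodf_neq0 => i _; move: i; near: t; exact: h1.
apply/prodf_neq0 => i _; apply/prodf_neq0 => j ij.
rewrite mulf_neq0 ?invr_eq0 // mulf_neq0 //.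
  rewrite /perturb mulrACA -exprD.
  by move: i j {ij}; near: t; exact: h2.
have -> : perturb t i / perturb t j = c i / c j * ray t ^+ ((n - i) - (n - j)).
  have le : (n - j <= n - i)%N by rewrite leq_sub2l // ltnW.
  rewrite /perturb -{1}(subnK le) exprD; field.
  by rewrite expf_neq0 // c0.
by move: i j ij; near: t; exact: h3.
Unshelve. all: by end_near. Qed.

End Perturb.

(** Both sides are continuous along [perturb], and agree for small t > 0 by the
    generic case. *)
Lemma det_antisym_lagrange n (c x z : 'I_n.+1 -> C) :
  (forall k, c k != 0) -> (forall k, x k != 0) -> (forall k, z k != 0) ->
  \det (\matrix_(i, k) antisym p c (lagrange p (norm_of sp c) z k) (x i)) * deltaA p (norm_of sp c) z =
  deltaC p sp x * constC p sp c * deltaA p (norm_of sp c) z ^+ n.+1.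
Proof.
move=> c0 x0 z0.
have norm00 : norm_of sp (perturb c 0) != 0 by apply: (norm_of_neq0 p0 hsp); exact: perturb00.
have cA : cont0 (fun t => deltaA p (norm_of sp (perturb c t)) z).
  exact: (cont0_deltaA (cont0_norm c0) norm00 z0).
have cL : cont0 (fun t => \det (\matrix_(i, k)
    antisym p (perturb c t) (lagrange p (norm_of sp (perturb c t)) z k) (x i)) *
    deltaA p (norm_of sp (perturb c t)) z).
  apply: cont0M; last exact: cA.
  apply: (@cont0_det _ _ (fun i k t => antisym p (perturb c t) (lagrange p (norm_of sp (perturb c t)) z k) (x i))).
  by move=> i k; exact: cont0_antisym.
have cR : cont0 (fun t => deltaC p sp x * constC p sp (perturb c t) *
    deltaA p (norm_of sp (perturb c t)) z ^+ n.+1).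
  apply: cont0M; last exact: cont0X cA.
  by apply: cont0M; [exact: cont0_cst|exact: cont0_constC].
have := cont0_eq cL cR; rewrite perturb0; apply.
by apply: filterS (deltaC_near c0) => t [ct dt]; exact: det_antisym_generic.
Qed.

(** Expand the g_j in Lagrange functions: g_j = sum_k g_j (z_k) e_k / deltaA z. *)
Lemma det_antisym_transfer n (c x z : 'I_n.+1 -> C) (g : 'I_n.+1 -> C -> C) (s : C) :
  s != 0 -> (forall k, x k != 0) -> (forall k, z k != 0) -> deltaA p s z != 0 ->
  (forall j, quasi p ((-1) ^+ n.+1 / s) n.+1 (g j)) ->
  \det (\matrix_(i, j) antisym p c (g j) (x i)) * deltaA p s z ^+ n.+1 =
  \det (\matrix_(i, k) antisym p c (lagrange p s z k) (x i)) * \det (\matrix_(k, j) g j (z k)).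
Proof.
move=> sn0 x0 z0 Dz qg.
have mult0 : (-1) ^+ n.+1 / s != 0 by apply: mulf_neq0; [rewrite expf_neq0 // oppr_eq0 oner_neq0|rewrite invr_eq0].
have dimV := dim_quasi p0 n mult0.
have ql k : quasi p ((-1) ^+ n.+1 / s) n.+1 (lagrange p s z k) by exact: (deltaA_multi p0 p1 sn0).
have gE j t : t != 0 -> deltaA p s z * g j t = \sum_k lagrange p s z k t * g j (z k).
  move=> t0; pose f t := -1 * (\sum_k g j (z k) * lagrange p s z k t) + deltaA p s z * g j t.
  have : f t = 0.
    apply: (eq0_at_nodes dimV ql z0) => //.
    - by move=> i k ik; exact: lagrange_offdiag.
    - by move=> k; rewrite lagrange_diag.
    - by apply: quasiD; [exact: (closed_sum dimV)|exact: quasiZ].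
    - move=> i; rewrite /f (bigD1 i) //= big1 => [|k ki]; last first.
        by rewrite lagrange_offdiag ?mulr0 // eq_sym.
      by rewrite lagrange_diag addr0 mulN1r mulrC addNr.
  rewrite /f mulN1r => /eqP; rewrite addrC subr_eq0 => /eqP ->.
  by apply: eq_bigr => k _; rewrite mulrC.
have e : deltaA p s z *: (\matrix_(i, j) antisym p c (g j) (x i)) =
    (\matrix_(i, k) antisym p c (lagrange p s z k) (x i)) *m (\matrix_(k, j) g j (z k)).
  apply/matrixP => i j; rewrite !mxE /antisym mulrBr.
  rewrite mulrCA gE // mulrCA gE ?invr_eq0 // !mulr_sumr -sumrB.
  by apply: eq_bigr => k _; rewrite !mxE mulrBl !mulrA.
by rewrite mulrC -detZ e det_mulmx.
Qed.

Lemma prod_lt_const n (a : 'I_n -> C) :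
  \prod_(i < n) \prod_(j < n | (i < j)%N) a j = \prod_j a j ^+ j.
Proof.
rewrite (exchange_big_dep xpredT) //=; apply: eq_bigr => j _.
rewrite prodr_const; congr (_ ^+ _).
rewrite -sum1_card -(big_mkord (fun k => (k < j)%N) (fun=> 1%N)).
rewrite -(@big_nat_widen _ _ _ 0 j n xpredT (fun=> 1%N)) ?sum_nat_const_nat ?muln1 ?subn0 //.
exact: ltnW.
Qed.

(** Combines [det_antisym_lagrange] and [det_antisym_transfer] with [typeA_eval];
    the nodes z and the powers of deltaA z cancel. *)
Theorem det_antisym n (c x a : 'I_n.+1 -> C) (P : 'I_n.+1 -> C -> C) :
  (forall k, c k != 0) -> (forall k, x k != 0) -> (forall k, a k != 0) ->
  th (sp * \prod_k c k * \prod_k a k) != 0 ->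
  (forall j : 'I_n.+1, quasi p
     ((-1) ^+ j.+1 * (sp * \prod_k c k * \prod_(k < n.+1 | (j < k)%N) a k)) j.+1 (P j)) ->
  \det (\matrix_(i, j) antisym p c
     (fun t => P j t * \prod_(k < n.+1 | (j < k)%N) th (a k * t)) (x i)) *
     th (sp * \prod_k c k * \prod_k a k) =
  (\prod_k a k) * th sp * (\prod_j P j (a j)^-1) * (\prod_k theta (- c k) sp) *
  (\prod_(i < n.+1) \prod_(j < n.+1 | (i < j)%N) th (c i * c j)) *
  (\prod_j a j ^+ j) * deltaC p sp x.
Proof.
move=> c0 x0 a0 hden qP.
have Pc0 : \prod_k c k != 0 by apply/prodf_neq0.
have Pa0 : \prod_k a k != 0 by apply/prodf_neq0.
set D := sp * \prod_k c k * \prod_k a k in hden *.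
have D0 : D != 0 by rewrite !mulf_neq0.
pose sigma := D^-1.
have sig0 : sigma != 0 by rewrite invr_eq0.
have thsig : th sigma = - D^-1 * th D by rewrite (thetaV p0 p1).
have thsig0 : th sigma != 0 by rewrite thsig mulf_neq0 // oppr_eq0 invr_eq0.
pose s := norm_of sp c.
have sn0 : s != 0 by exact: (norm_of_neq0 p0 hsp).
have sE : sigma * \prod_k a k = s by rewrite /sigma /s /D /norm_of; field; rewrite Pa0 Pc0 s0.
have qP' (j : 'I_n.+1) : quasi p ((-1) ^+ j.+1 / (sigma * \prod_(k < n.+1 | (k <= j)%N) a k)) j.+1 (P j).
  have := qP j; congr quasi; rewrite -[LHS]mulr1 -mulrA; congr (_ * _); rewrite mulr1.
  have e : \prod_k a k = \prod_(k < n.+1 | (k <= j)%N) a k * \prod_(k < n.+1 | (j < k)%N) a k.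
    rewrite (bigID (fun k : 'I_n.+1 => (k <= j)%N) predT) /=; congr (_ * _).
    by apply: eq_bigl => k; rewrite ltnNge.
  have A0 : \prod_(k < n.+1 | (k <= j)%N) a k != 0 by apply/prodf_neq0.
  have B0 : \prod_(k < n.+1 | (j < k)%N) a k != 0 by apply/prodf_neq0.
  by rewrite /sigma /D e; field; rewrite A0 B0 Pc0 s0.
pose G (j : 'I_n.+1) t := P j t * \prod_(k < n.+1 | (j < k)%N) th (a k * t).
have qG j : quasi p ((-1) ^+ n.+1 / s) n.+1 (G j) by rewrite -sE; exact: quasi_entry.
have [r [r0 Dz]] : exists r : C, r != 0 /\ deltaA p s (fun i : 'I_n.+1 => 1 * r ^+ (n.+1 - i)) != 0.
  apply: (deltaA_generic p0 p1 sn0 (oner_neq0 _)) => [i j ij|].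
    by move: (ltn_ord j) ij; clear; lia.
  by left; rewrite big_ord_recl /= subn0.
pose z (i : 'I_n.+1) := 1 * r ^+ (n.+1 - i).
have z0 i : z i != 0 by rewrite mulf_neq0 ?oner_neq0 // expf_neq0.
have h1 := det_antisym_transfer c sn0 x0 z0 Dz qG.
have h2 := det_antisym_lagrange c0 x0 z0.
have h3 := typeA_eval p0 p1 sig0 thsig0 a0 z0 qP'.
rewrite -/(deltaA p _ z) sE in h3.
have thV : th sp^-1 = - sp^-1 * th sp by rewrite (thetaV p0 p1).
have alg (d dz m E L X Q t PP AA : C) : dz != 0 -> m != 0 -> d * m = L * E ->
   L * dz = X * Q * m -> E * t = dz * (PP * AA) -> d * t = X * Q * PP * AA.
  move=> hD hm e1 e2 e3; apply: (mulIf (mulf_neq0 hm hD)).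
  have -> : d * t * (m * dz) = (d * m) * t * dz by ring.
  rewrite e1; have -> : L * E * t * dz = L * dz * (E * t) by ring.
  by rewrite e2 e3; ring.
have m0 : deltaA p s z ^+ n.+1 != 0 by rewrite expf_neq0.
rewrite big_split /= in h3.
have := alg _ _ _ _ _ _ _ _ _ _ Dz m0 h1 h2 h3.
rewrite thsig /constC thV.
set d := \det _; set X := deltaC _ _ _; set V := \prod_i theta _ _; set S := \prod_i \prod_(j | _) _.
set PP := \prod_j P _ _; set AA := \prod_j _ ^+ _; set PA := \prod_k a k; set PC := \prod_k c k.
move=> e; have -> : d * th D = (d * (- D^-1 * th D)) * (- D) by field.
rewrite e /D -/PA -/PC; field.
by rewrite s0 Pc0.
Qed.

End Final.

(** * The determinant evaluation *)

Section Holomorphic.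
Local Open Scope classical_set_scope.
Local Open Scope complex_scope.
Import ComplexField.Normc.

Lemma holomorphic_hol (R : realType) (f : R[i] -> R[i]) : holomorphic_on_Cstar f -> hol f.
Proof.
move=> hf z z0; have /cvg_ex[/= d hd] := hf z z0.
exists (fun w => if w == z then d else (f w - f z) / (w - z)); last first.
  move=> w; case: eqVneq => [->|wz]; first by rewrite subrr mulr0 addr0.
  by rewrite divfK ?subr_eq0 // addrC subrK.
apply/contCP => e e0; rewrite eqxx.
move/(@cvgrPdist_lt _ R[i]^o) : hd => /(_ e%:C); rewrite ltcR => /(_ e0).
rewrite near_withinE => /nbhsCP[k k0 hk].
apply/nbhsCP; exists k => // w wk; case: eqVneq => [_|wz]; first by rewrite subrr normc0.
have := hk (w - z); rewrite subr0 subr_eq0 => /(_ wk wz).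
rewrite normE ltcR normcC /GRing.scale /= mulr1 subrK mulrC; exact.
Qed.

Lemma normc_lt1 (R : realType) (p : R[i]) : `|p| < 1 -> normc p < 1.
Proof. by rewrite -ltcR. Qed.

End Holomorphic.

(* sp is the chosen square root of p.  Indices in 'I_n start from 0: the index
   j stands for j + 1, so P j is an A_j theta function. *)
Theorem corollary4p12 (R : realType) (p sp : R[i])
  (hp0 : 0 < `|p|) (hp1 : `|p| < 1) (hsp : sp ^+ 2 = p)
  (n : nat) (x a c : 'I_n -> R[i])
  (hx : forall i, x i != 0) (ha : forall i, a i != 0)
  (hc : forall i, c i != 0)
  (P : 'I_n -> R[i] -> R[i])
  (hP : forall j : 'I_n,
     A_theta p j
       ((sp * (\prod_(k < n) c k) * \prod_(k < n | (j < k)%N) a k)^-1)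
       (P j))
  (hden : theta (sp * (\prod_(k < n) c k) * \prod_(k < n) a k) p != 0) :
  \det (\matrix_(i < n, j < n)
    (x i ^- n * (\prod_(k < n) theta (c k * x i) p) * P j (x i)
       * (\prod_(k < n | (j < k)%N) theta (a k * x i) p)
     - x i ^+ n.+1 * (\prod_(k < n) theta (c k * (x i)^-1) p) * P j ((x i)^-1)
       * (\prod_(k < n | (j < k)%N) theta (a k * (x i)^-1) p)))
  = (\prod_(i < n) a i) * theta sp p
      / theta (sp * (\prod_(k < n) c k) * \prod_(k < n) a k) p
    * (\prod_(i < n) P i (1 / a i))
    * (\prod_(i < n) theta (- c i) sp)
    * (\prod_(i < n) \prod_(j < n | (i < j)%N) theta (c i * c j) p)
    * (\prod_(i < n) theta (x i) sp)
    * (\prod_(i < n) \prod_(j < n | (i < j)%N)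
         (a j * (x i)^-1 * (theta (x i * x j) p * theta (x i / x j) p))).
Proof.
have p0 : p != 0 by rewrite -normr_gt0.
have p1 := normc_lt1 hp1.
case: n x a c hx ha hc P hP hden => [|n] x a c hx ha hc P hP hden.
  by rewrite det_mx00; move: hden; rewrite !big_ord0 !mulr1 mul1r => hden; rewrite divff.
have qP (j : 'I_n.+1) : quasi p
     ((-1) ^+ j.+1 * (sp * \prod_k c k * \prod_(k < n.+1 | (j < k)%N) a k)) j.+1 (P j).
  have [s0 hf eP] := hP j; split=> [|t t0]; first exact: holomorphic_hol.
  rewrite eP // invfM invrK mulrA //.
have main := det_antisym p0 p1 hsp hc hx ha hden qP.
apply: (mulIf hden); move: main.
set M := (X in \det X * _ = _); set M' := (X in _ -> \det X * _ = _).
have -> : M' = M.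
  by apply/matrixP => i j; rewrite !mxE /antisym /thprod !mulrA.
move=> ->; rewrite /deltaC -prod_lt_const.
have -> : \prod_(i < n.+1) P i (1 / a i) = \prod_(i < n.+1) P i (a i)^-1.
  by apply: eq_bigr => i _; rewrite div1r.
have -> : \prod_(i < n.+1) \prod_(j < n.+1 | (i < j)%N)
         (a j * (x i)^-1 * (theta (x i * x j) p * theta (x i / x j) p)) =
   (\prod_(i < n.+1) \prod_(j < n.+1 | (i < j)%N) a j) *
   \prod_(i < n.+1) \prod_(j < n.+1 | (i < j)%N)
     ((x i)^-1 * (theta (x i * x j) p * theta (x i / x j) p)).
  rewrite -big_split; apply: eq_bigr => i _; rewrite -big_split; apply: eq_bigr => j _ /=.
  by rewrite -!mulrA.
field; exact: hden.
Qed.
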